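(* Let $\left((X_{t})_{t\geq 0},(\mathbb{P}_{x})_{x>0}\right)$ be a $1/\alpha$-positive self-similar Markov process ($\alpha>0$) and let $\xi$ be the Lévy process associated to it via Lamperti's transformation. Assume that $X$ never hits zero and that $\xi$ drifts towards $\infty$. Then the family of measures $(\mu_{t}, t>0)$ defined by $$\mu_{s}f:=\widehat{\mathbb{E}}\left(f\left(\left(\frac{s}{I}\right)^{1/\alpha}\right)I^{-1}\right),\qquad s>0,$$ for $f:\mathbb{R}^{+}\to\mathbb{R}^{+}$ measurable, forms a $0$-self-similar entrance law ($0$-ssel) for $(X_{t},t\geq 0)$.
   Context: A $1/\alpha$-positive self-similar Markov process ($1/\alpha$-pssMp), $\alpha>0$, is a $[0,\infty)$-valued càdlàg strong Markov process $X$ with laws $(\mathbb{P}_x)$ such that for every $c>0$ and $x\ge 0$ the law of $(cX_{tc^{-\alpha}},t\geq0)$ under $\mathbb{P}_x$ is $\mathbb{P}_{cx}$. The point $0$ is a cemetery state, and $T_0=\inf\{t>0:X_t=0\}$; ''never hits zero'' means $T_0=\infty$, $\mathbb{P}_x$-a.s. for $x>0$. Lamperti's transformation: a Lévy process $\xi$ with values in $\mathbb{R}\cup\{-\infty\}$ is a real Lévy process sent to the absorbing state $-\infty$ at an independent exponential time $\zeta$ of parameter $q\ge0$ ($q=0$ means $\zeta=\infty$ a.s.). Every $1/\alpha$-pssMp started from $x>0$ can be written $X_t=x\exp(\xi_{\tau(tx^{-\alpha})})$ if $\tau(tx^{-\alpha})<\zeta$, and $X_t=0$ otherwise, where $\tau(t)=\inf\{s>0:\int_0^s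 e^{\alpha\xi_u}du>t\}$ ($\inf\emptyset=\infty$) and $\xi$ is such a Lévy process, started from $0$ under the reference measure $\mathbb{P}$, whose law does not depend on $x$. This $\xi$ is the Lévy process associated to $X$; when $X$ never hits zero, $\zeta=\infty$ a.s. ''$\xi$ drifts towards $\infty$'' means $\lim_{t\to\infty}\xi_t=\infty$ a.s. $I:=\int_0^{\zeta}\exp(\alpha\xi_s)\,ds$, viewed as a functional of the canonical Lévy path, and $\widehat{\mathbb{E}}$ is the expectation under the law $\widehat{\mathbb{P}}$ of the dual process $-\xi$ under $\mathbb{P}$. Thus, under $\widehat{\mathbb{P}}$, $I$ has the law of $\int_0^\infty e^{-\alpha\xi_s}ds$ under $\mathbb{P}$. Self-similar entrance law: for $\gamma\ge0$, a family of $\sigma$-finite measures $(\eta_t,t>0)$ on $(0,\infty)$ is a $\gamma$-self-similar entrance law ($\gamma$-ssel) for $X$ if (EL-i) for all $s>0$, $t\ge0$ and positive measurable $f:(0,\infty)\to\mathbb{R}$, $\int_{(0,\infty)}\eta_s(dx)\mathbb{E}_x[f(X_t),t<T_0]=\int_{(0,\infty)}\eta_{t+s}(dx)f(x)$; and (EL-ii) for all $s>0$ and positive measurable $f$, $\eta_sf=s^{-\gamma/\alpha}\eta_1H_{s^{1/\alpha}}f$, where $H_cf(x)=f(cx)$ and $\eta f=\int f\,d\eta$. *)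

(* Defs.v *)
(* MathComp-Analysis *)
From HB Require Import structures.
From mathcomp Require Import all_boot all_order all_algebra.
From mathcomp Require Import all_classical all_reals all_analysis.
From mathcomp Require Import measurable_realfun.
Set Implicit Arguments.
Unset Strict Implicit.
Unset Printing Implicit Defensive.
Import Order.TTheory GRing.Theory Num.Theory.
Import numFieldNormedType.Exports.
Local Open Scope classical_set_scope.
Local Open Scope ring_scope.

(* Time is [0, +oo[; a path is a function R -> R (or R -> \bar R) of which only
   the values at nonnegative times matter. *)

Section Paths.
Context {R : realType}.
Implicit Types (w : R -> R) (v : R -> \bar R) (alpha x t : R).

Definition cadlag w : Prop :=
  (forall t : R, 0 <= t -> w @ t^'+ --> w t) /\
  (forall t : R, 0 < t -> cvg (w @ t^'-)).

(* The sigma-algebra generated by the coordinates at nonnegative times. *)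
Definition path_events : set (set (R -> R)) :=
  <<s [set C | exists (t : R) (B : set R),
         [/\ 0 <= t, measurable B & C = [set w | B (w t)]] ] >>.

Definition T0 w : \bar R :=
  ereal_inf [set t%:E | t in [set t | 0 < t /\ w t = 0]].

Definition lifetime v : \bar R :=
  ereal_inf [set t%:E | t in [set t | 0 <= t /\ v t = -oo%E]].

(* Below, expeR -oo = 0. *)
Definition time_change alpha v t : \bar R :=
  ereal_inf [set s%:E | s in [set s | 0 < s /\
    (t%:E < \int[lebesgue_measure]_(u in `[0%R, s]) expeR (alpha%:E * v u))%E]].

Definition lamperti alpha x v t : R :=
  let tau := time_change alpha v (t * x `^ (- alpha)) in
  if (tau < lifetime v)%E then x * expR (fine (v (fine tau))) else 0.

Definition exp_functional alpha v : \bar R :=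
  (\int[lebesgue_measure]_(s in [set s : R | (0 <= s)%R /\ s%:E < lifetime v])
     expeR (alpha%:E * v s))%E.

(* The dual of a killed path is killed at the same time: -oo is the cemetery. *)
Definition dual_path v : R -> \bar R :=
  fun t => if v t == -oo%E then -oo%E else (- v t)%E.

End Paths.

Section Laws.
Context {R : realType}.

Definition same_law d1 (T1 : measurableType d1) (P1 : probability T1 R)
    (X1 : R -> T1 -> R) d2 (T2 : measurableType d2) (P2 : probability T2 R)
    (X2 : R -> T2 -> R) : Prop :=
  forall C, path_events C ->
    P1 [set w | C (X1 ^~ w)] = P2 [set w | C (X2 ^~ w)].

Context d (T : measurableType d).
Implicit Types (F : R -> set (set T)) (X : R -> T -> R) (tau : T -> \bar R).

Definition filtration F : Prop :=
  [/\ forall t : R, 0 <= t -> sigma_algebra setT (F t),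
      forall t : R, 0 <= t -> F t `<=` measurable &
      forall s t : R, 0 <= s -> s <= t -> F s `<=` F t].

Definition adapted F X : Prop :=
  forall (t : R) (B : set R), 0 <= t -> measurable B -> F t (X t @^-1` B).

Definition stopping_time F tau : Prop :=
  (forall w, (0 <= tau w)%E) /\
  (forall t : R, 0 <= t -> F t [set w | (tau w <= t%:E)%E]).

Definition stopped_events F tau : set (set T) :=
  [set A | measurable A /\
     forall t : R, 0 <= t -> F t (A `&` [set w | (tau w <= t%:E)%E])].

(* P x is the law under which X starts from x; only x >= 0 is relevant. *)
Definition strong_markov F X (P : R -> probability T R) : Prop :=
  forall (x : R) tau A C, 0 <= x -> stopping_time F tau ->
    stopped_events F tau A -> path_events C ->
    let A' := A `&` [set w | (tau w < +oo)%E] in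
    P x (A' `&` [set w | C (fun t => X (fine (tau w) + t) w)]) =
    (\int[P x]_(w in A')
       P (X (fine (tau w)) w) [set w' | C (X ^~ w')])%E.

(* A 1/alpha-positive self-similar Markov process. *)
Record pssMp (alpha : R) F X (P : R -> probability T R) : Prop := PssMp {
  pssMp_filtration : filtration F ;
  pssMp_adapted : adapted F X ;
  pssMp_ge0 : forall (t : R) w, 0 <= t -> 0 <= X t w ;
  pssMp_cadlag : forall w, cadlag (X ^~ w) ;
  pssMp_cemetery : forall (s t : R) w,
    0 <= s -> s <= t -> X s w = 0 -> X t w = 0 ;
  pssMp_start : forall x : R, 0 <= x -> {ae P x, forall w, X 0 w = x} ;
  pssMp_kernel : forall C, path_events C ->
    measurable_fun (`[0, +oo[ : set R) (fun x => P x [set w | C (X ^~ w)]) ;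
  pssMp_markov : strong_markov F X P ;
  pssMp_scaling : forall c x : R, 0 < c -> 0 <= x ->
    same_law (P x) (fun t w => c * X (t * c `^ (- alpha)) w) (P (c * x)) X }.

Definition never_hits_zero X (P : R -> probability T R) : Prop :=
  forall x : R, 0 < x -> {ae P x, forall w, T0 (X ^~ w) = +oo%E}.

End Laws.

Section Levy.
Context {R : realType} d (W : measurableType d) (Q : probability W R).

Record levy (Y : R -> W -> R) : Prop := Levy {
  levy_measurable : forall t : R, 0 <= t -> measurable_fun setT (Y t) ;
  levy_cadlag : forall w, cadlag (Y ^~ w) ;
  levy_start : {ae Q, forall w, Y 0 w = 0} ;
  levy_stationary : forall (s t : R) (B : set R), 0 <= s -> 0 <= t -> measurable B ->
    Q [set w | B (Y (s + t) w - Y s w)] = Q [set w | B (Y t w)] ;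
  levy_independent : forall n (t : nat -> R) (B : nat -> set R),
    0 <= t 0%N -> (forall i, t i <= t i.+1) -> (forall i, measurable (B i)) ->
    Q (\bigcap_(i in `I_n) [set w | B i (Y (t i.+1) w - Y (t i) w)]) =
    (\prod_(i < n) Q [set w | B i (Y (t i.+1) w - Y (t i) w)%R])%E }.

(* Exponential of parameter q >= 0, the parameter 0 meaning infinite. *)
Definition exponential_time (q : R) (zeta : W -> \bar R) : Prop :=
  [/\ measurable_fun setT zeta, forall w, (0 <= zeta w)%E,
      q = 0 -> {ae Q, forall w, zeta w = +oo%E} &
      0 < q -> forall B : set R, measurable B ->
        Q (zeta @^-1` (EFin @` B)) = exponential_prob q B].

Definition independent_time (Y : R -> W -> R) (zeta : W -> \bar R) : Prop :=
  forall C (B : set (\bar R)), path_events C -> measurable B ->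
    Q ([set w | C (Y ^~ w)] `&` zeta @^-1` B) =
    (Q [set w | C (Y ^~ w)] * Q (zeta @^-1` B))%E.

Definition killed_levy (xi : R -> W -> \bar R) : Prop :=
  exists (q : R) (Y : R -> W -> R) (zeta : W -> \bar R),
  [/\ 0 <= q, levy Y, exponential_time q zeta, independent_time Y zeta &
      forall (t : R) w, 0 <= t ->
        xi t w = if (t%:E < zeta w)%E then (Y t w)%:E else -oo%E].

Definition drifts_to_infinity (xi : R -> W -> \bar R) : Prop :=
  {ae Q, forall w, xi t w @[t --> +oo%R] --> +oo%E}.

(* Expectation of a path functional under the law of the dual of xi. *)
Definition dual_expectation (xi : R -> W -> \bar R)
    (G : (R -> \bar R) -> \bar R) : \bar R :=
  (\int[Q]_w G (dual_path (xi ^~ w)))%E.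

End Levy.

(* xi is the Levy process associated to X by Lamperti's transformation. *)
Definition lamperti_associated {R : realType} (alpha : R)
    d (T : measurableType d) (X : R -> T -> R) (P : R -> probability T R)
    d' (W : measurableType d') (Q : probability W R) (xi : R -> W -> \bar R) :=
  forall x : R, 0 < x ->
    same_law (P x) X Q (fun t w => lamperti alpha x (xi ^~ w) t).

Section EntranceLaw.
Context {R : realType} d (T : measurableType d).

(* Measures on ]0, +oo[ are represented as measures on R null outside it. *)
Record ssel (alpha gamma : R) (X : R -> T -> R) (P : R -> probability T R)
    (eta : R -> {measure set R -> \bar R}) : Prop := Ssel {
  ssel_index : 0 <= gamma ;
  ssel_support : forall s : R, 0 < s -> eta s (~` `]0, +oo[) = 0%E ;
  ssel_sigma_finite : forall s : R, 0 < s -> sigma_finite setT (eta s) ;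
  ssel_entrance : forall (s t : R) (f : R -> R), 0 < s -> 0 <= t ->
    measurable_fun (`]0, +oo[ : set R) f -> (forall x : R, 0 < x -> 0 <= f x) ->
    (\int[eta s]_(x in `]0%R, +oo[)
       \int[P x]_(w in [set w | t%:E < T0 (X ^~ w)]) (f (X t w))%:E =
     \int[eta (t + s)%R]_(x in `]0%R, +oo[) (f x)%:E)%E ;
  ssel_scaling : forall (s : R) (f : R -> R), 0 < s ->
    measurable_fun (`]0, +oo[ : set R) f -> (forall x : R, 0 < x -> 0 <= f x) ->
    (\int[eta s]_(x in `]0%R, +oo[) (f x)%:E =
     (s `^ (- (gamma / alpha)))%R%:E *
       \int[eta 1%R]_(x in `]0%R, +oo[) (f (s `^ alpha^-1 * x)%R)%:E)%E }.

End EntranceLaw.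

(* Main.v *)
(* Write y for the Levy path, J = int_0^oo e^(-alpha y), A_u = int_0^u e^(alpha y),
   B_u = int_0^u e^(-alpha y), and R_v f(x) for the expectation of
   f(e^(-v/alpha) X_(e^v - 1)) when X starts from x. By self-similarity the
   entrance property says that eta g = E[J^-1 g(J^(-1/alpha))] is invariant under
   the semigroup (R_v).

   The first step is int_0^oo eta(R_v psi_v) dv = int_0^oo eta(psi_v) dv for every
   jointly measurable psi >= 0. On the left, J and the path driving R_v are
   independent, and one substitutes e^v = 1 + A_u / J; on the right one substitutes
   e^(-v) = 1 - B_u / J. The two integrands then have the same expectation for each
   fixed u: reversing the path on [0, u] and continuing with an independent copy
   gives a Levy path with the same law, and this turns (J, y_u, B_u) into
   (e^(-alpha y_u) (A_u + J'), y_u, e^(-alpha y_u) A_u) with J' independent of y.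

   Apply this to psi_w = 1_(w <= v) R_(v-w) f and to psi_w = 1_(w <= v) f. Together
   with the Markov property, v eta(R_v f) = int_0^v eta(R_(v-w) f) dw
   = int_0^v eta(R_w f) dw = v eta(f). *)
Require Import Defs.
From HB Require Import structures.
From mathcomp Require Import all_boot all_order all_algebra.
From mathcomp Require Import all_classical all_reals all_analysis.
From mathcomp Require Import measurable_realfun ring lra.
Set Implicit Arguments.
Unset Strict Implicit.
Unset Printing Implicit Defensive.
Import Order.TTheory GRing.Theory Num.Theory.
Import numFieldNormedType.Exports.
Local Open Scope classical_set_scope.
Local Open Scope ring_scope.

(** * Measure theory on the half-line *)

(** For a fixed v the invariance of eta cannot be read off from path reversal: a deterministic v
    corresponds to a random time u of the Levy path, whereas reversal preserves the law only at
    deterministic u. Integrating over v exchanges the two roles, and the weight J^-1 is exactly what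
    makes the Jacobians of the two substitutions match after reversal. Taking psi independent of v
    would be useless: when eta(f) > 0 the identity then has an infinite right-hand side. A cut-off
    depending on v is what allows a single time to be recovered.

    The clocks A and B are integrals of functions with jumps, so they need not be differentiable and
    the substitution rule is proved for primitives of a nonnegative measurable density.

    The semigroup property of (R_v) is not derived from the time-changed Levy path, which would
    require the strong Markov property at random times of that path. It is inherited from X: the two
    sides share their one-dimensional marginals, and the Markov property of X at a constant time
    then passes to expectations over two independent Levy paths. *)

Section weighted_pushforward.
Local Open Scope ereal_scope.
Context d1 d2 (T1 : measurableType d1) (T2 : measurableType d2) (R : realType).
Variables (mu : {measure set T1 -> \bar R}) (rho : T1 -> R) (g : T1 -> T2).
Variables (mrho : measurable_fun setT rho) (rho0 : forall x, (0 <= rho x)%R).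
Variable mg : measurable_fun setT g.

(* The proof arguments are phantoms: they make the measure structure inferable. *)
Definition wpush (_ : measurable_fun setT rho) (_ : forall x, (0 <= rho x)%R)
  (_ : measurable_fun setT g) (A : set T2) : \bar R :=
  \int[mu]_x ((rho x)%:E * (\1_A (g x))%:E).

Local Notation nu := (wpush mrho rho0 mg).

Let mindic (A : set T2) : measurable A ->
  measurable_fun setT (fun x => (rho x)%:E * (\1_A (g x))%:E).
Proof.
move=> mA; apply: emeasurable_funM; apply/measurable_EFinP => //.
exact: measurableT_comp (@measurable_indic _ _ R setT _ mA) mg.
Qed.

Let wpush0 : nu set0 = 0.
Proof. by rewrite /wpush integral0_eq// => x _; rewrite indic0 mule0. Qed.

Let wpush_ge0 A : 0 <= nu A.
Proof. by apply: integral_ge0 => x _; rewrite mule_ge0// lee_fin. Qed.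

Let wpush_sigma_additive : semi_sigma_additive nu.
Proof.
move=> F mF tF mUF; rewrite [X in _ --> X](_ : _ =
  \int[mu]_x (\sum_(n <oo) ((rho x)%:E * (\1_(F n) (g x))%:E))); last first.
  apply: eq_integral => x _; rewrite nneseriesZl; last by move=> n _; rewrite lee_fin.
  congr (_ * _).
  apply/esym/cvg_lim => //.
  exact: (@measure_semi_sigma_additive _ _ R (\d_(g x)) F).
rewrite integral_nneseries//; last 2 first.
  by move=> n; exact: mindic.
  by move=> n x _; rewrite mule_ge0// lee_fin.
apply: is_cvg_nneseries => n _ _; exact: wpush_ge0.
Qed.

HB.instance Definition _ := isMeasure.Build _ _ R nu
  wpush0 wpush_ge0 wpush_sigma_additive.

Import HBNNSimple.

(** True by definition for indicators, hence for simple functions and their increasing limits.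
    Measures of this form serve both for the change of variables and for the entrance law itself. *)
Lemma integral_wpush (h : T2 -> \bar R) : measurable_fun setT h ->
  (forall y, 0 <= h y) -> \int[nu]_y h y = \int[mu]_x ((rho x)%:E * h (g x)).
Proof.
move=> mh h0; pose f_ := nnsfun_approx measurableT mh.
have cf y : (f_ n y)%:E @[n --> \oo] --> h y by exact: cvg_nnsfun_approx.
have ndf y : {homo (fun n => (f_ n y)%:E) : m n / (m <= n)%N >-> m <= n}.
  by move=> m n mn; rewrite lee_fin; exact/lefP/nd_nnsfun_approx.
have mfg n : measurable_fun setT (fun x => (rho x)%:E * (f_ n (g x))%:E).
  apply/emeasurable_funM; apply/measurable_EFinP => //.
  exact: (measurableT_comp _ mg).
transitivity (\int[nu]_y (limn (fun n => (f_ n y)%:E))).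
  by apply/eq_integral => y _; exact/esym/cvg_lim.
rewrite monotone_convergence//; last 2 first.
  by move=> n; exact/measurable_EFinP.
  by move=> n y _; rewrite lee_fin.
transitivity (\int[mu]_x (limn (fun n => (rho x)%:E * (f_ n (g x))%:E))); last first.
  by apply/eq_integral => x _; apply/cvg_lim => //; exact: cvgeZl.
rewrite monotone_convergence//; last 2 first.
  by move=> n x _; rewrite mule_ge0// lee_fin.
  by move=> x _ m n mn; rewrite lee_wpmul2l ?lee_fin//; exact/lefP/nd_nnsfun_approx.
congr (limn _); apply/funext => n.
under eq_integral do rewrite fimfunE -fsumEFin//.
rewrite ge0_integral_fsum//; last 2 first.
  by move=> r; exact/measurable_EFinP/measurableT_comp.
  by move=> r z _; rewrite EFinM nnfun_muleindic_ge0.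
transitivity (\int[mu]_x \sum_(k \in range (f_ n))
    (k%:E * ((rho x)%:E * (\1_(f_ n @^-1` [set k]) (g x))%:E))).
  rewrite ge0_integral_fsum//; last 2 first.
  - by move=> r; apply: measurable_funeM; exact: mindic.
  - move=> r x _; have [r0|r0] := leP 0%R r; first by rewrite !mule_ge0 ?lee_fin.
    by rewrite preimage_nnfun0// indic0 !mule0.
  apply: eq_fsbigr => r _.
  have [r0|r0] := leP 0%R r; last first.
    rewrite preimage_nnfun0// !integral0_eq// => x _.
      by rewrite indic0 !mule0.
    by rewrite indic0 mulr0.
  under eq_integral do rewrite EFinM.
  rewrite !ge0_integralZl//=.
  - by rewrite integral_indic// setIT.
  - exact: mindic.
  - by move=> x _; rewrite mule_ge0// lee_fin.
  - exact/measurable_EFinP.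
apply: eq_integral => x _.
rewrite [in RHS]fimfunE -fsumEFin// ge0_mule_fsumr//; last first.
  by move=> r; rewrite EFinM nnfun_muleindic_ge0.
by apply: eq_fsbigr => r _; rewrite EFinM muleCA.
Qed.

End weighted_pushforward.

(** * Change of variables for the primitive of a nonnegative density *)

Section substitution.
Context (R : realType).
Local Notation mu := (@lebesgue_measure R).
Local Open Scope ereal_scope.
Variables (g rho : R -> R).
Hypotheses (mg : measurable_fun setT g) (mrho : measurable_fun setT rho).
Hypothesis rho0 : forall x, (0 <= rho x)%R.
Hypothesis grho : forall u, (0 <= u)%R ->
  \int[mu]_(x in `[0%R, u]) (rho x)%:E = (g u)%:E.
Hypothesis gmono : {in `[0%R, +oo[ &, {homo g : x y / (x < y)%R}}.

Let g0 : g 0 = 0%R.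
Proof. by have := grho (lexx _); rewrite set_itv1 integral_set1 => -[]. Qed.

Let gle (x y : R) : (0 <= x)%R -> (0 <= y)%R -> (g x <= g y)%R = (x <= y)%R.
Proof.
move=> x0 y0; apply/idP/idP => [|xy].
  by apply: contraTT; rewrite -!ltNge => yx; apply: gmono; rewrite ?in_itv/= ?andbT.
move: xy; rewrite le_eqVlt => /predU1P[->//|xy].
by apply/ltW/gmono; rewrite ?in_itv/= ?andbT.
Qed.

Let gsurj (u c : R) : (0 <= u)%R -> (0 <= c <= g u)%R ->
  exists2 w, (0 <= w <= u)%R & g w = c.
Proof.
move=> u0 cu.
have cg : {within `[0%R, u], continuous g}.
  have cI : {within `[0%R, u], continuous (fun x => parameterized_integral mu 0%R x rho)}.
    apply: parameterized_integral_continuous => //.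
    apply/integrableP; split; first exact/measurable_EFinP/measurable_funTS.
    under eq_integral do rewrite gee0_abs ?lee_fin//.
    by rewrite grho// ltry.
  apply: subspace_eq_continuous cI => x /[!inE]/=; rewrite in_itv/= => /andP[x0 _].
  by rewrite /from_subspace/= /parameterized_integral /Rintegral grho.
have [w] : exists2 w, w \in `[0%R, u] & g w = c.
  by apply: IVT => //; rewrite g0 ge_min le_max (andP cu).1 (andP cu).2 orbT.
by rewrite in_itv/= => wu gw; exists w.
Qed.

(** Two measures are compared: the image under [g] of rho dx on [0, u], and Lebesgue measure on
    [0, g u]. They are tested on half-lines ]x, +oo[: all the mass if x < 0, none if x >= g u, and
    otherwise x = g w by the intermediate value theorem and both give g u - g w. *)
Let integral_subst_itv (u : R) (h : R -> \bar R) : (0 <= u)%R ->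
  measurable_fun setT h -> (forall c, 0 <= h c) ->
  \int[mu]_(x in `[0%R, u]) (h (g x) * (rho x)%:E) =
  \int[mu]_(c in `[0%R, g u]) h c.
Proof.
move=> u0 mh h0.
pose rho' := (rho \_ `[0%R, u])%R.
have mrho' : measurable_fun setT rho'.
  by apply/(measurable_restrictT _ _).1 => //; exact: measurable_funTS.
have rho'0 x : (0 <= rho' x)%R by rewrite /rho' patchE; case: ifP.
pose nu := wpush mu mrho' rho'0 mg.
pose I := `[0%R, g u]%classic.
have mI : measurable_fun setT (\1_I : R -> R) by apply: measurable_indic; exact: measurable_itv.
have I0 x : (0 <= (\1_I : R -> R) x)%R by [].
pose nu' := wpush mu mI I0 (@measurable_id _ R setT).
transitivity (\int[nu]_c h c).
  rewrite integral_wpush// [LHS]integral_mkcond; apply: eq_integral => x _.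
  by rewrite /rho' !patchE; case: ifP => _; rewrite ?mul0e// muleC.
transitivity (\int[nu']_c h c); last first.
  rewrite integral_wpush// [RHS]integral_mkcond; apply: eq_integral => x _.
  by rewrite patchE indicE; case: ifP => _; rewrite ?mul0e// mul1e.
have nuE A : nu A = \int[mu]_(x in `[0%R, u] `&` g @^-1` A) (rho x)%:E.
  rewrite /nu /wpush [RHS]integral_mkcond; apply: eq_integral => x _; rewrite indicE.
  have <- : (x \in g @^-1` A) = (g x \in A) by apply/idP/idP; rewrite !inE.
  rewrite /rho' !patchE in_setI; case: (x \in _) => /=; last by rewrite mul0e.
  by case: ifP; rewrite ?mule1 ?mule0.
have nu'E A : measurable A -> nu' A = mu (I `&` A).
  move=> mA; rewrite /nu' /wpush; transitivity (\int[mu]_x (\1_(I `&` A) x)%:E).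
    by apply: eq_integral => x _; rewrite indicI.
  by rewrite integral_indic ?setIT//; apply: measurableI => //; exact: measurable_itv.
apply: eq_measure_integral => A mA _.
apply: (measure_unique (@RGenOInfty.G R) (fun n => `](- n%:R)%R, +oo[%classic)).
- exact: RGenOInfty.measurableE.
- move=> _ _ [x ->] [y ->]; exists (Num.max x y); apply/seteqP; split => z /=.
    by rewrite !in_itv/= !andbT gt_max => -[-> ->].
  by rewrite !in_itv/= !andbT gt_max => /andP.
- by move=> n; exists (- n%:R)%R.
- apply/seteqP; split => // x _; exists (Num.truncn `|x|).+1 => //=.
  rewrite in_itv/= andbT ltrNl (le_lt_trans (ler_norm _))// normrN.
  by rewrite truncnS_gt.
- move=> _ [x ->].
  have mx : measurable `]x, +oo[%classic by [].
  transitivity (nu `]x, +oo[%classic) => //.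
  transitivity (nu' `]x, +oo[%classic) => //.
  rewrite nuE nu'E//.
  have [x0|x0] := ltP x 0%R.
    rewrite (_ : _ `&` _ = `[0%R, u]%classic).
      rewrite grho// (_ : _ `&` _ = `[0%R, g u]%classic).
        have : (0 <= g u)%R by rewrite -[leLHS]g0 gle.
        by rewrite lebesgue_measure_itv/= lte_fin sube0; case: ltgtP => // <-.
      apply/seteqP; split => z /=; rewrite /I/= !in_itv/= ?andbT; first by move=> -[].
      by move=> /andP[z0 zg]; rewrite z0 zg (lt_le_trans x0).
    apply/seteqP; split => z /=; rewrite !in_itv/= ?andbT; first by move=> -[].
    by move=> /andP[z0 zg]; rewrite z0 zg (lt_le_trans x0)// -[leLHS]g0 gle.
  have [xg|xg] := leP (g u) x.
    rewrite (_ : _ `&` _ = set0); last first.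
      apply/seteqP; split => z //=; rewrite !in_itv/= andbT => -[/andP[z0 zu]].
      by rewrite ltNge (le_trans _ xg)// gle.
    rewrite integral_set0 (_ : _ `&` _ = set0) ?measure0//.
    apply/seteqP; split => z //=; rewrite /I/= !in_itv/= andbT => -[/andP[z0 zu]].
    by rewrite ltNge (le_trans zu).
  have [w /andP[w0 wu] gw] := gsurj u0 (introT andP (conj x0 (ltW xg))).
  rewrite (_ : `[0%R, u] `&` _ = `]w, u]%classic); last first.
    apply/seteqP; split => z /=; rewrite !in_itv/= ?andbT.
      by move=> [/andP[z0 ->]]; rewrite -gw ltNge gle// -ltNge andbT.
    move=> /andP[wz ->]; have z0 : (0 <= z)%R by rewrite (le_trans w0)// ltW.
    by rewrite z0 -gw ltNge gle// -ltNge.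
  rewrite (_ : I `&` _ = `]x, g u]%classic); last first.
    apply/seteqP; split => z /=; rewrite /I/= !in_itv/= ?andbT.
      by move=> [/andP[z0 ->] ->].
    by move=> /andP[xz ->]; rewrite xz (le_trans x0)// ltW.
  rewrite lebesgue_measure_itv/= lte_fin xg -gw.
  have := grho u0.
  rewrite (@itv_bndbnd_setU _ _ _ (BRight w)) ?bnd_simp//.
  rewrite ge0_integral_setU//=.
  - by rewrite grho// => <-; rewrite addeAC subee// add0e.
  - by apply/measurable_EFinP/measurable_funTS.
  - by move=> z _; rewrite lee_fin.
  - rewrite disj_set2E; apply/eqP/seteqP; split => z //=; rewrite !in_itv/=.
    by move=> [/andP[_ zw] /andP[wz _]]; move: (lt_le_trans wz zw); rewrite ltxx.
- move=> n; suff : nu `](- n%:R)%R, +oo[%classic < +oo by [].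
  rewrite nuE (@le_lt_trans _ _ (\int[mu]_(x in `[0%R, u]) (rho x)%:E))//.
    apply: ge0_subset_integral => //.
    + by apply: measurableI => //; rewrite -[X in measurable X]setTI; exact: mg.
    + by apply/measurable_EFinP/measurable_funTS.
    + by move=> z _; rewrite lee_fin.
  by rewrite grho// ltry.
- exact: mA.
Qed.

(** [L] plays the part of the supremum of [g] on the half-line, possibly infinite and never
    attained. Both sides are exhausted along the integers. *)
Lemma integral_subst (L : \bar R) (h : R -> \bar R) :
  (forall u, (0 <= u)%R -> (g u)%:E < L) ->
  (forall c, (0 <= c)%R -> c%:E < L -> exists2 u, (0 <= u)%R & (c <= g u)%R) ->
  measurable_fun setT h -> (forall c, 0 <= h c) ->
  \int[mu]_(x in `[0%R, +oo[) (h (g x) * (rho x)%:E) =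
  \int[mu]_(c in [set c | (0 <= c)%R /\ c%:E < L]) h c.
Proof.
move=> gL Lg mh h0.
have <- : \bigcup_n `[0%R, n%:R]%classic = `[0%R, +oo[%classic :> set R.
  apply/seteqP; split => [z [n _]/=|z]; rewrite /= !in_itv/= andbT; first by case/andP.
  move=> z0; exists (Num.truncn z).+1 => //=.
  by rewrite in_itv/= z0 ltW// truncnS_gt.
have <- : \bigcup_n `[0%R, g n%:R]%classic = [set c | (0 <= c)%R /\ c%:E < L].
  apply/seteqP; split => [z [n _]/=|z /= [z0 zL]].
    rewrite in_itv/= => /andP[-> zg]; split => //.
    by rewrite (le_lt_trans _ (gL n%:R _))// lee_fin.
  have [u u0 zgu] := Lg _ z0 zL.
  exists (Num.truncn u).+1 => //=.
  by rewrite in_itv/= z0 (le_trans zgu)// gle// ltW// truncnS_gt.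
have ndn (F : R -> R) : {in `[0%R, +oo[ &, {homo F : x y / (x <= y)%R}} ->
    nondecreasing_seq (fun n => `[0%R, F n%:R]%classic).
  move=> ndF m n mn; rewrite subsetEset; apply: subset_itvl; rewrite bnd_simp.
  by apply: ndF; rewrite ?in_itv/= ?andbT// ler_nat.
have mhg : measurable_fun setT (fun x => h (g x) * (rho x)%:E).
  apply: emeasurable_funM; last exact/measurable_EFinP.
  exact: (measurableT_comp mh).
have hg0 x : 0 <= h (g x) * (rho x)%:E by rewrite mule_ge0// lee_fin.
transitivity (limn (fun n => \int[mu]_(x in `[0%R, n%:R]) (h (g x) * (rho x)%:E))).
  apply/esym/cvg_lim => //; apply: ge0_nondecreasing_set_cvg_integral => //.
    exact: (ndn id).
  by move=> n; exact: measurable_funTS.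
transitivity (limn (fun n => \int[mu]_(c in `[0%R, g n%:R]) h c)).
  by congr (limn _); apply/funext => n; exact: integral_subst_itv.
apply/cvg_lim => //; apply: ge0_nondecreasing_set_cvg_integral => //.
  by apply: ndn => x y; rewrite !in_itv/= !andbT => x0 y0; rewrite gle.
by move=> n; exact: measurable_funTS.
Qed.

End substitution.

(** * Right-continuous paths with left limits *)

Section paths.
Context (R : realType).
Implicit Types (y g : R -> R).
Local Notation mu := (@lebesgue_measure R).

(* Two-sided version of [cadlag]: time ranges over the whole line. *)
Definition rcll y := forall t : R, y @ t^'+ --> y t /\ cvg (y @ t^'-).

Lemma rcll_cadlag (w : R -> R) : cadlag w -> rcll (fun t => w (Num.max 0 t) - w 0).
Proof.
move=> [rw lw] t; split.
  apply: cvgB; last exact: cvg_cst.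
  have [t0|t0] := ltP t 0.
    apply: cvg_near_cst; near=> s; rewrite max_l//; apply: ltW.
    by near: s; exact: nbhs_right_lt.
  apply: cvg_trans (rw t t0).
  apply: near_eq_cvg; near=> s; rewrite max_r//; apply: (le_trans t0); apply: ltW.
  by near: s; exact: nbhs_right_gt.
apply: is_cvgB; last exact: is_cvg_cst.
have [t0|t0] := leP t 0.
  apply/cvg_ex; exists (w 0); apply: cvg_near_cst; near=> s; rewrite max_l//.
  apply: (le_trans _ t0); apply: ltW.
  by near: s; exact: nbhs_left_lt.
have /cvg_ex[l wl] := lw t t0; apply/cvg_ex; exists l.
apply: cvg_trans wl; apply: near_eq_cvg; near=> s; rewrite max_r//; apply: ltW.
by near: s; exact: nbhs_left_gt.
Unshelve. all: by end_near. Qed.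

Lemma rcll_loc_bounded y t : rcll y ->
  exists e M : R, 0 < e /\ forall s, t - e < s < t + e -> `|y s| <= M.
Proof.
move=> /(_ t)[/cvgrPdist_le /(_ 1 ltr01) yr /cvg_ex[l /cvgrPdist_le /(_ 1 ltr01) yl]].
move: yr; rewrite /at_right near_withinE => /nbhs_ballP[e1 /= e10 H1].
move: yl; rewrite /at_left near_withinE => /nbhs_ballP[e2 /= e20 H2].
exists (Num.min e1 e2), (`|y t| + `|l| + 1); split; first by rewrite lt_min e10.
move=> s /andP[]; rewrite ltrBlDr => se1 se2.
have [st|ts|->] := ltgtP s t; last by rewrite -addrA lerDl addr_ge0.
  have /H2 : ball t e2 s.
    rewrite /ball/= ger0_norm ?subr_ge0 1?ltW// ltrBlDl (lt_le_trans se1)//.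
    by rewrite lerD2l ge_min lexx orbT.
  move=> /(_ st); rewrite ler_distl => /andP[h1 h2].
  rewrite ler_norml; have := ler_norm l; have := ler_norm (- l); rewrite normrN.
  have := normr_ge0 (y t); lra.
have /H1 : ball t e1 s.
  rewrite /ball/= distrC ger0_norm ?subr_ge0 1?ltW// ltrBlDl (lt_le_trans se2)//.
  by rewrite lerD2l ge_min lexx.
move=> /(_ ts); rewrite ler_distl => /andP[h1 h2].
rewrite ler_norml; have := ler_norm (y t); have := ler_norm (- y t); rewrite normrN.
have := normr_ge0 l; lra.
Qed.

(** One-sided limits bound the path near each time, and finitely many such neighbourhoods cover a
    segment. *)
Lemma rcll_bounded y (a b : R) : rcll y ->
  exists M : R, forall s, a <= s <= b -> `|y s| <= M.
Proof.
move=> ry.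
have H t : exists eM : R * R, 0 < eM.1 /\ forall s, t - eM.1 < s < t + eM.1 -> `|y s| <= eM.2.
  by have [e [M [e0 h]]] := rcll_loc_bounded t ry; exists (e, M).
have [f fP] := choice H.
have := @segment_compact R a b; rewrite compact_cover.
move=> /(_ R setT (fun t => ball t (f t).1)) [].
- by move=> t _; apply: ball_open; exact: (fP t).1.
- by move=> t _; exists t => //; apply: ballxx; exact: (fP t).1.
move=> D _ cD; exists (\big[Num.max/0]_(t <- finmap.enum_fset D) (f t).2) => s.
move=> sab; have [t /= tD ts] := cD s sab.
apply: (@le_trans _ _ (f t).2).
  apply: (fP t).2; move: ts; rewrite /ball/= ltr_distlC; lra.
exact: (@le_bigmax_seq _ _ _ (finmap.enum_fset D) 0 t xpredT (fun u => (f u).2) tD isT).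
Qed.

(* The first point of the grid h Z strictly to the right of r: evaluating a path there
   lets right-continuity alone justify the approximation. *)
Definition gridup (h r : R) : R := h * (Num.floor (r / h) + 1)%:~R.

Lemma gridup_gt (h r : R) : 0 < h -> r < gridup h r.
Proof. by move=> h0; rewrite /gridup mulrC -ltr_pdivrMr// floorD1_gt. Qed.

Lemma gridup_le (h r : R) : 0 < h -> gridup h r <= r + h.
Proof.
move=> h0; rewrite /gridup intrD mulrDr mulr1 lerD2r mulrC -ler_pdivlMr//.
exact: ge_floor.
Qed.

Lemma gridup_def (h r : R) (z : int) : 0 < h ->
  h * z%:~R <= r < h * (z + 1)%:~R -> gridup h r = h * (z + 1)%:~R.
Proof.
move=> h0 hz; rewrite /gridup (@floor_def _ _ z)//.
by rewrite ler_pdivlMr// ltr_pdivrMr// ![_ * h]mulrC.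
Qed.

Lemma gridup_cvg (h : nat -> R) (V : topologicalType) (g : R -> V) (r : R) (l : V) :
  (forall n, 0 < h n) -> h @ \oo --> 0 -> g @ r^'+ --> l ->
  g (gridup (h n) r) @[n --> \oo] --> l.
Proof.
move=> h0 hc gl; apply: (cvg_comp (fun n => gridup (h n) r) g) gl.
have c : gridup (h n) r @[n --> \oo] --> r.
  apply: (@squeeze_cvgr _ _ _ _ (cst r) (fun n => r + h n)).
  - by near=> n; rewrite gridup_le// ltW// gridup_gt.
  - exact: cvg_cst.
  - by rewrite -[X in _ --> X]addr0; apply: cvgD => //; exact: cvg_cst.
move=> U /c cU; rewrite /nbhs/=.
apply: (@filterS _ \oo _ (fun n => r < gridup (h n) r -> U (gridup (h n) r))); last exact: cU.
by move=> n; apply; exact: gridup_gt.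
Unshelve. all: by end_near. Qed.

(** The approximations through [gridup] depend on time only via the cell containing it, so each
    preimage is a countable union of rectangles. *)
Lemma right_cts_measurable d (W : measurableType d) (Z : R -> W -> R) :
  (forall t, measurable_fun setT (Z t)) ->
  (forall t w, Z s w @[s --> t^'+] --> Z t w) ->
  measurable_fun setT (fun p : R * W => Z p.1 p.2).
Proof.
move=> mZ rZ; pose h n := n.+1%:R^-1 : R.
have h0 n : 0 < h n by rewrite invr_gt0.
apply: (@measurable_fun_cvg _ _ _ _ (fun n p => Z (gridup (h n) p.1) p.2)); last first.
  move=> [t w] _; apply: (gridup_cvg (g := Z ^~ w)) (rZ t w) => //.
  exact: cvg_harmonic.
move=> n _ B mB; rewrite setTI.
rewrite [X in measurable X](_ : _ = \bigcup_(z in @setT int)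
   ([set r : R | h n * z%:~R <= r < h n * (z + 1)%:~R] `*`
    (Z (h n * (z + 1)%:~R) @^-1` B))).
  apply: countable_bigcupT_measurable => // z; apply: measurableX; last first.
    by rewrite -[X in measurable X]setTI; exact: mZ.
  by rewrite (_ : [set _ | _] = `[h n * z%:~R, h n * (z + 1)%:~R[%classic).
apply/seteqP; split => [[r w] /= Bw|[r w] [z _ /= [zr Bw]]].
  exists (Num.floor (r / h n)) => //=; split => //.
  by rewrite gridup_gt// andbT mulrC -ler_pdivlMr// ge_floor.
by rewrite (gridup_def _ zr).
Qed.

Lemma measurable_gridup (h : R) : 0 < h -> measurable_fun setT (gridup h).
Proof.
move=> h0; apply: nondecreasing_measurable => // x y xy.
rewrite /gridup ler_pM2l// ler_int lerD2r le_floor// ler_pM2r// invr_gt0//.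
Qed.

Lemma integral_gridup (g : R -> R) (h : R) K : 0 < h -> measurable_fun setT g ->
  (forall r, 0 <= g r) ->
  (\int[mu]_(r in `[0%R, (h * K%:R)%R[) (g (gridup h r))%:E =
   (\sum_(k < K) h * g (h * k.+1%:R))%:E)%E.
Proof.
move=> h0 mg g0; elim: K => [|K IH].
  by rewrite mulr0 set_itvco0 integral_set0 big_ord0.
have mgg : measurable_fun setT (fun r => (g (gridup h r))%:E).
  apply/measurable_EFinP; apply: (measurableT_comp mg); exact: measurable_gridup.
have -> : `[0, (h * K.+1%:R)%R[%classic =
    `[0, (h * K%:R)%R[%classic `|` `[(h * K%:R)%R, (h * K.+1%:R)%R[%classic.
  apply: itv_bndbnd_setU; rewrite bnd_simp ?mulr_ge0// ?(ltW h0)//.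
  by rewrite ler_pM2l// ler_nat.
rewrite ge0_integral_setU//=.
- rewrite IH big_ord_recr/= EFinD; congr (_ + _)%E.
  rewrite (eq_integral (cst (g (h * K.+1%:R))%:E)).
    rewrite integral_cst//.
    have muE : mu `[(h * K%:R)%R, (h * K.+1%:R)%R[%classic = h%:E.
      rewrite lebesgue_measure_itv/= lte_fin ltr_pM2l// ltr_nat ltnS leqnn.
      by rewrite -EFinD -mulrBr -natrB ?subSnn// mulr1.
    by rewrite [h * g _]mulrC EFinM; congr (_ * _)%E; exact: muE.
  move=> r; rewrite inE/= in_itv/= => /andP[r1 r2].
  have KE : (K%:Z + 1)%:~R = K.+1%:R :> R by rewrite intrD -pmulrn natr1.
  by rewrite (@gridup_def _ _ K) ?KE// -?pmulrn ?r1.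
- exact: measurable_funTS.
- by move=> r _; rewrite lee_fin.
- rewrite disj_set2E; apply/eqP/seteqP; split => z //=; rewrite !in_itv/=.
  by move=> [/andP[_ zw] /andP[wz _]]; move: (lt_le_trans zw wz); rewrite ltxx.
Qed.

Lemma dyadic_cvg0 (u : R) : u / 2 ^+ n @[n --> \oo] --> 0.
Proof.
rewrite -(mulr0 u); apply: cvgM; first exact: cvg_cst.
under eq_fun do rewrite -exprVn.
by apply: cvg_expr; rewrite ger0_norm// invf_lt1// ltr1n.
Qed.

(** The sum is the integral of [g] composed with [gridup], to which dominated convergence applies.
    The bound reaches beyond the interval because the next grid point may lie one mesh further, and
    the mesh is at most u. *)
Lemma riemann_right (g : R -> R) (u M : R) (N : nat) : 0 < u ->
  measurable_fun setT g -> (forall r, 0 <= g r) ->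
  (forall r, 0 <= r <= u * N%:R + u -> g r <= M) ->
  (forall r, g @ r^'+ --> g r) ->
  ((\sum_(k < N * 2 ^ n) u / 2 ^+ n * g (u / 2 ^+ n * k.+1%:R))%:E @[n --> \oo] -->
    \int[mu]_(r in `[0%R, (u * N%:R)%R]) (g r)%:E)%E.
Proof.
move=> u0 mg g0 gM gr; pose h n : R := u / 2 ^+ n.
have h0 n : 0 < h n by rewrite divr_gt0// exprn_gt0.
have hu n : h n <= u.
  rewrite ler_pdivrMr ?exprn_gt0//; apply: ler_peMr; first exact: ltW.
  by rewrite -natrX ler1n expn_gt0.
have M0 : 0 <= M.
  by apply: (le_trans (g0 0)); apply: gM; rewrite lexx/= addr_ge0 ?mulr_ge0 ?(ltW u0).
rewrite -integral_itv_bndo_bndc; last by apply/measurable_EFinP/measurable_funTS.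
rewrite [X in X @ _](_ : _ = (fun n => \int[mu]_(r in `[0%R, (u * N%:R)%R[)
    (g (gridup (h n) r))%:E)%E); last first.
  apply/funext => n; rewrite -integral_gridup//; last exact: h0.
  by rewrite natrM natrX mulrCA mulfVK ?expf_neq0// [N%:R * u]mulrC.
apply: (@dominated_cvg _ _ _ mu _ _ _ _ (cst M%:E)) => //.
- move=> n; apply/measurable_EFinP/measurable_funTS; apply: (measurableT_comp mg).
  exact: measurable_gridup.
- move=> r _; apply: cvg_EFin; first exact: nearW.
  by apply: gridup_cvg => //; exact: dyadic_cvg0.
- apply/integrableP; split => //.
  have muy : (mu `[0%R, (u * N%:R)%R[%classic < +oo)%E.
    by rewrite lebesgue_measure_itv/=; case: ifP => // _; rewrite -EFinD ltry.
  by rewrite integral_cst//; apply: lte_mul_pinfty.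
- move=> n r /=; rewrite in_itv/= => /andP[r0 rN].
  rewrite lee_fin ger0_norm//; apply: gM.
  apply/andP; split; first by apply: (le_trans r0); exact/ltW/gridup_gt.
  by apply: (le_trans (gridup_le _ (h0 n))); apply: lerD; [exact: ltW|exact: hu].
Qed.

(** Left endpoints approach a time from the side on which nothing is known about [g]. Shifting the
    index by one gives right endpoints at the cost of two boundary terms, whose factor, the mesh,
    tends to 0. *)
Lemma riemann_left (g : R -> R) (u M : R) (N : nat) : 0 < u ->
  measurable_fun setT g -> (forall r, 0 <= g r) ->
  (forall r, 0 <= r <= u * N%:R + u -> g r <= M) ->
  (forall r, g @ r^'+ --> g r) ->
  ((\sum_(k < N * 2 ^ n) u / 2 ^+ n * g (u / 2 ^+ n * k%:R))%:E @[n --> \oo] -->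
    \int[mu]_(r in `[0%R, (u * N%:R)%R]) (g r)%:E)%E.
Proof.
move=> u0 mg g0 gM gr.
rewrite [X in X @ _](_ : _ = (fun n =>
    (\sum_(k < N * 2 ^ n) u / 2 ^+ n * g (u / 2 ^+ n * k.+1%:R))%:E +
    ((u / 2 ^+ n) * (g 0 - g (u * N%:R)))%:E)%E); last first.
  apply/funext => n; rewrite -EFinD; congr EFin.
  have tel m (a : nat -> R) : \sum_(k < m) a k = \sum_(k < m) a k.+1 + (a 0%N - a m).
    elim: m => [|m IH]; first by rewrite !big_ord0 add0r subrr.
    by rewrite !big_ord_recr/= IH; ring.
  rewrite (tel _ (fun k => u / 2 ^+ n * g (u / 2 ^+ n * k%:R))) mulr0 -mulrBr.
  congr (_ + _ * (_ - g _)).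
  by rewrite natrM natrX mulrCA mulfVK ?expf_neq0// mulrC.
have c0 : (((u / 2 ^+ n) * (g 0 - g (u * N%:R)))%:E @[n --> \oo] --> 0)%E.
  apply: cvg_EFin; first exact: nearW.
  rewrite /= -[X in _ --> X](mul0r (g 0 - g (u * N%:R))).
  by apply: cvgM; [exact: dyadic_cvg0|exact: cvg_cst].
have := cvgeD _ (riemann_right u0 mg g0 gM gr) c0.
by rewrite adde0; apply; rewrite fin_num_adde_defl.
Qed.

Lemma right_cts_measurable1 y : (forall t, y @ t^'+ --> y t) -> measurable_fun setT y.
Proof.
move=> ry.
have H : measurable_fun setT (fun p : R * unit => y p.1).
  apply: (@right_cts_measurable _ unit (fun t _ => y t)) => [t|t _]; last exact: ry.
  exact: measurable_cst.
apply: (measurableT_comp H (g := fun t => (t, tt))).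
by apply: measurable_fun_pair => //; exact: measurable_cst.
Qed.

End paths.

(** * The Lamperti clock and changes of variables along a path *)

Section clock.
Context (R : realType).
Local Notation mu := (@lebesgue_measure R).

(** An admissible time stays admissible when enlarged, so rational times suffice; measurability of
    the time change becomes a countable matter. *)
Lemma time_change_lt (al : R) (v : R -> \bar R) (c r : R) :
  measurable_fun (`[0, +oo[ : set R) (fun u => expeR (al%:E * v u)) ->
  (time_change al v c < r%:E)%E <->
  exists q : rat, [/\ 0 < ratr q :> R, ratr q < r &
    (c%:E < \int[mu]_(u in `[0%R, ratr q]) expeR (al%:E * v u))%E].
Proof.
move=> mv; split.
  move=> /ereal_inf_lt[_ [s [s0 cs] <-]]; rewrite lte_fin => sr.
  have [q] := rat_in_itvoo sr; rewrite in_itv/= => /andP[sq qr].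
  exists q; split => //; first exact: lt_trans sq.
  apply: (lt_le_trans cs); apply: ge0_subset_integral => //.
  - apply: measurable_funS mv => //.
    by apply: subset_itv => //; rewrite bnd_simp.
  - by move=> x _; exact: expeR_ge0.
  - by apply: subset_itvl; rewrite bnd_simp ltW.
move=> [q [q0 qr cq]]; apply: (@le_lt_trans _ _ (ratr q)%:E); last by rewrite lte_fin.
by apply: ereal_inf_lbound; exists (ratr q).
Qed.

Lemma measurable_time_change d (T : measurableType d) (al : R) (c : T -> R)
    (v : T -> R -> \bar R) : measurable_fun setT c ->
  (forall t, measurable_fun (`[0, +oo[ : set R) (fun u => expeR (al%:E * v t u))) ->
  (forall q : R, measurable_fun setT
     (fun t => \int[mu]_(u in `[0%R, q]) expeR (al%:E * v t u))%E) ->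
  measurable_fun setT (fun t => time_change al (v t) (c t)).
Proof.
move=> mc mv mI; apply: (measurability _ (ErealGenInftyO.measurableE R)) => //.
move=> _ [_ [r ->] <-]; rewrite setTI.
rewrite [X in measurable X](_ : _ = \bigcup_(q in [set q : rat | 0 < ratr q :> R /\ ratr q < r])
    [set t | ((c t)%:E < \int[mu]_(u in `[0%R, ratr q]) expeR (al%:E * v t u))%E]).
  rewrite bigcup_mkcond; apply: bigcupT_measurable_rat => q; case: ifPn => // _.
  rewrite -[X in measurable X]setTI; apply: measurable_lte => //.
  exact/measurable_EFinP.
apply/seteqP; split => t /=; rewrite in_itv/=.
  by move=> /(time_change_lt _ _ (mv t))[q [q0 qr cq]]; exists q.
by move=> [q [q0 qr] cq]; apply/(time_change_lt _ _ (mv t)); exists q.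
Qed.

(** This is A_u when a = al and B_u when a = - al. The integral is finite along [rcll] paths, so
    [fine] loses nothing there. *)
Definition clock (a : R) (y : R -> R) (u : R) : R :=
  fine (\int[mu]_(r in `[0%R, u]) (expR (a * y r))%:E)%E.

Section path.
Variables (a : R) (y : R -> R).
Hypothesis ry : rcll y.

Let my : measurable_fun setT y.
Proof. by apply: right_cts_measurable1 => t; have [] := ry t. Qed.

Lemma measurable_expR_path : measurable_fun setT (fun r => expR (a * y r)).
Proof.
apply: measurableT_comp => //; apply: measurableT_comp => //.
Qed.

Lemma right_cts_expR_path t : expR (a * y r) @[r --> t^'+] --> expR (a * y t).
Proof.
apply: continuous_cvg; first exact: continuous_expR.
by apply: cvgM; [exact: cvg_cst|have [] := ry t].
Qed.

(** The upper bound gives finiteness of the clock, the positive lower bound its strict growth. *)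
Lemma expR_path_bounds (u : R) : exists mM : R * R,
  0 < mM.1 /\ forall r, 0 <= r <= u -> mM.1 <= expR (a * y r) <= mM.2.
Proof.
have [M yM] := rcll_bounded 0 u ry.
exists (expR (- (`|a| * M)), expR (`|a| * M)); split; first exact: expR_gt0.
move=> r ru; rewrite !ler_expR.
have : `|a * y r| <= `|a| * M by rewrite normrM ler_wpM2l// yM.
by rewrite ler_norml.
Qed.

Let mE (D : set R) : measurable_fun D (fun r => (expR (a * y r))%:E).
Proof.
apply/measurable_EFinP; apply: measurable_funTS; exact: measurable_expR_path.
Qed.

Lemma clockE u : (\int[mu]_(r in `[0%R, u]) (expR (a * y r))%:E = (clock a y u)%:E)%E.
Proof.
rewrite /clock fineK//; have [[m M]/= [_ H]] := expR_path_bounds u.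
rewrite ge0_fin_numE; last by apply: integral_ge0 => r _; rewrite lee_fin expR_ge0.
apply: (@le_lt_trans _ _ (\int[mu]_(r in `[0%R, u]) (cst M%:E) r)%E).
  apply: ge0_le_integral => //.
  - exact: mE.
  - move=> r; rewrite /= in_itv/= => ru; rewrite lee_fin.
    by have /andP[] := H r ru.
rewrite integral_cst//.
have muE : mu `[0, u]%classic = (Num.max 0 u)%:E.
  by rewrite lebesgue_measure_itv/= lte_fin sube0; case: ltP.
have -> : (M%:E * (mu `[0%R, u]%classic) < +oo)%E by rewrite muE -EFinM ltry.
by [].
Qed.

Lemma clock_mono : {in `[0, +oo[ &, {homo clock a y : s u / s < u}}.
Proof.
move=> s u; rewrite !in_itv/= !andbT => s0 u0 su.
rewrite -lte_fin -!clockE.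
have -> : `[0%R, u]%classic = `[0%R, s]%classic `|` `]s, u]%classic.
  by apply: itv_bndbnd_setU; rewrite bnd_simp// ltW.
rewrite ge0_integral_setU//=.
- rewrite clockE lteDl//.
  have [[m M]/= [m0 H]] := expR_path_bounds u.
  apply: (@lt_le_trans _ _ (\int[mu]_(r in `]s, u]) (cst m%:E) r)%E).
    rewrite integral_cst//.
    have muE : mu `]s, u]%classic = (u - s)%:E.
      by rewrite lebesgue_measure_itv/= lte_fin su.
    have -> : (0 < m%:E * (mu `]s, u]%classic))%E.
      by rewrite muE -EFinM lte_fin mulr_gt0// subr_gt0.
    by [].
  apply: ge0_le_integral => //.
  + by move=> r _; rewrite lee_fin ltW.
  + exact: mE.
  + move=> r; rewrite /= in_itv/= => /andP[sr ru]; rewrite lee_fin.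
    by have /andP[] := H r (introT andP (conj (le_trans s0 (ltW sr)) ru)).
- exact: mE.
- rewrite disj_set2E; apply/eqP/seteqP; split => z //=; rewrite !in_itv/=.
  by move=> [/andP[_ zw] /andP[wz _]]; move: (le_lt_trans zw wz); rewrite ltxx.
Qed.

End path.
End clock.

Section clock_subst.
Context (R : realType).
Local Notation mu := (@lebesgue_measure R).

Section path.
Variables (a : R) (y : R -> R).
Hypothesis ry : rcll y.

Lemma clock_ge0 u : 0 <= clock a y u.
Proof. by rewrite -lee_fin -clockE// integral_ge0// => r _; rewrite lee_fin expR_ge0. Qed.

Lemma clock_nd : {homo clock a y : s u / s <= u}.
Proof.
move=> s u su; have [s0|s0] := ltP s 0.
  have -> : clock a y s = 0.
    by apply: EFin_inj; rewrite -clockE// set_itv_ge ?bnd_simp -?ltNge// integral_set0.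
  exact: clock_ge0.
move: su; rewrite le_eqVlt => /predU1P[->//|su].
by apply/ltW/clock_mono => //; rewrite in_itv/= andbT// (le_trans s0)// ltW.
Qed.

Lemma measurable_clock : measurable_fun setT (clock a y).
Proof. by apply: nondecreasing_measurable => //; exact: clock_nd. Qed.

Lemma clock_subst (h : R -> \bar R) :
  measurable_fun setT h -> (forall c, 0 <= h c)%E ->
  (\int[mu]_(u in `[0%R, +oo[) (h (clock a y u) * (expR (a * y u))%:E) =
   \int[mu]_(c in [set c | (0 <= c)%R /\ c%:E <
      \int[mu]_(r in `[0%R, +oo[) (expR (a * y r))%:E]) h c)%E.
Proof.
move=> mh h0.
have mE (D : set R) : measurable_fun D (fun r => (expR (a * y r))%:E).
  by apply/measurable_EFinP; apply: measurable_funTS; exact: measurable_expR_path.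
have E0 r : (0%R <= (expR (a * y r))%:E)%E by rewrite lee_fin expR_ge0.
apply: integral_subst => //.
- exact: measurable_clock.
- exact: measurable_expR_path.
- by move=> u _; exact: clockE.
- exact: clock_mono.
- move=> u u0; apply: (@lt_le_trans _ _ (clock a y (u + 1))%:E).
    by rewrite lte_fin; apply: clock_mono => //; rewrite ?in_itv/= ?andbT ?addr_ge0// ltrDl.
  rewrite -clockE//; apply: ge0_subset_integral => //.
    exact: mE.
  apply: subset_itvl.
  by rewrite bnd_simp.
(* If no u reached c, the clock would stay below c at all integers and its total mass could not
   exceed c. *)
- move=> c c0 cL; apply: contrapT => /forall2NP H.
  have Hn n : clock a y n%:R <= c by have [/(_ (ler0n _ n))|/negP] := H n%:R; rewrite // -ltNge => /ltW.
  move: cL; rewrite ltNge => /negP; apply.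
  have <- : \bigcup_n `[0%R, n%:R]%classic = `[0%R, +oo[%classic :> set R.
    apply/seteqP; split => [z [n _]/=|z]; rewrite /= !in_itv/= andbT; first by case/andP.
    move=> z0; exists (Num.truncn z).+1 => //=.
    by rewrite in_itv/= z0 ltW// truncnS_gt.
  have cv : (\int[mu]_(r in `[0%R, n%:R]) (expR (a * y r))%:E @[n --> \oo] -->
      \int[mu]_(r in \bigcup_n `[0%R, n%:R]%classic) (expR (a * y r))%:E)%E.
    apply: ge0_nondecreasing_set_cvg_integral => //; last by move=> n; exact: mE.
    by move=> m n mn; rewrite subsetEset; apply: subset_itvl; rewrite bnd_simp ler_nat.
  rewrite -(cvg_lim _ cv)//; apply: lime_le; first by apply/cvg_ex; eexists; exact: cv.
  by apply: nearW => n; rewrite clockE// lee_fin.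
Qed.

End path.

Section transient.
Variables (al : R) (y : R -> R).
Hypotheses (al0 : 0 < al) (ry : rcll y) (yoo : y t @[t --> +oo] --> +oo).

Lemma clock_total : (\int[mu]_(r in `[0%R, +oo[) (expR (al * y r))%:E = +oo)%E.
Proof.
have /cvgryPge/(_ 0)[M [Mr yM]] := yoo.
(* The limit controls times strictly beyond M, hence M + 1; from [N] on the integrand is at least
   1. *)
pose N := Num.max 0 (M + 1).
apply/eqP; rewrite -leye_eq.
apply: (@le_trans _ _ (\int[mu]_(r in `[N, +oo[) (cst 1%:E) r)%E).
  rewrite integral_cst//.
  have muE : mu `[N, +oo[%classic = +oo%E by rewrite lebesgue_measure_itv/= ltry.
  by have -> : (1%:E * mu `[N, +oo[%classic = +oo)%E by rewrite mul1e muE.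
have mE (D : set R) : measurable_fun D (fun r => (expR (al * y r))%:E).
  by apply/measurable_EFinP; apply: measurable_funTS; exact: measurable_expR_path.
apply: (@le_trans _ _ (\int[mu]_(r in `[N, +oo[) (expR (al * y r))%:E)%E).
  apply: ge0_le_integral => //; first exact: mE.
  move=> r.
  rewrite /= in_itv/= andbT ge_max => /andP[r0 Mr1]; rewrite lee_fin -expR0 ler_expR.
  apply: mulr_ge0; first exact: ltW.
  by apply: yM; rewrite (lt_le_trans _ Mr1)// ltrDl.
apply: ge0_subset_integral => //.
  exact: mE.
  by apply: subset_itvr; rewrite bnd_simp le_max lexx.
Qed.

Lemma clock_unbounded c : exists2 u, 0 <= u & c < clock al y u.
Proof.
apply: contrapT => /forall2NP H.
have : (\int[mu]_(r in `[0%R, +oo[) (expR (al * y r))%:E <= c%:E)%E.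
  have <- : \bigcup_n `[0%R, n%:R]%classic = `[0%R, +oo[%classic :> set R.
    apply/seteqP; split => [z [n _]/=|z]; rewrite /= !in_itv/= andbT; first by case/andP.
    move=> z0; exists (Num.truncn z).+1 => //=.
    by rewrite in_itv/= z0 ltW// truncnS_gt.
  have cv : (\int[mu]_(r in `[0%R, n%:R]) (expR (al * y r))%:E @[n --> \oo] -->
      \int[mu]_(r in \bigcup_n `[0%R, n%:R]%classic) (expR (al * y r))%:E)%E.
    apply: ge0_nondecreasing_set_cvg_integral => //.
      by move=> m n mn; rewrite subsetEset; apply: subset_itvl; rewrite bnd_simp ler_nat.
    by move=> n; apply/measurable_EFinP; apply: measurable_funTS; exact: measurable_expR_path.
  rewrite -(cvg_lim _ cv)//; apply: lime_le; first by apply/cvg_ex; eexists; exact: cv.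
  apply: nearW => n; rewrite clockE// lee_fin.
  by have [/(_ (ler0n _ n))//|/negP] := H n%:R; rewrite -leNgt.
by rewrite clock_total.
Qed.

(** Strict growth of the clock makes its generalized inverse an exact one: no earlier time exceeds
    the level and every later one does. *)
Lemma time_change_clock u : 0 <= u ->
  time_change al (EFin \o y) (clock al y u) = u%:E.
Proof.
move=> u0; apply/eqP; rewrite eq_le; apply/andP; split; last first.
  apply: le_ereal_inf_tmp => _ [s [s0 us] <-]; rewrite lee_fin leNgt; apply/negP => su.
  move: us; rewrite [X in (_ < X)%E](clockE al ry) lte_fin ltNge => /negP; apply.
  by apply: clock_nd => //; exact: ltW.
apply/lee_addgt0Pr => e e0; rewrite -EFinD; apply: ereal_inf_lbound.
exists (u + e) => //; split; first by rewrite ltr_wpDl.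
rewrite [X in (_ < X)%E](clockE al ry) lte_fin; apply: clock_mono => //.
- by rewrite in_itv/= andbT.
- by rewrite in_itv/= andbT addr_ge0// ltW.
- by rewrite ltrDl.
Qed.

Lemma time_change_fin c : (time_change al (EFin \o y) c < +oo)%E.
Proof.
have [u u0 cu] := clock_unbounded c.
apply: (@le_lt_trans _ _ (u + 1)%:E); last by rewrite ltry.
apply: ereal_inf_lbound; exists (u + 1) => //; split; first by rewrite ltr_wpDl.
rewrite [X in (_ < X)%E](clockE al ry) lte_fin (lt_le_trans cu)//.
by apply: clock_nd => //; rewrite lerDl.
Qed.

End transient.
End clock_subst.

(* The cases a = 1 and a = -1 are the substitutions c = j (e^v - 1) and c = j (1 - e^(-v)). *)
Section exp_subst.
Context (R : realType).
Local Notation mu := (@lebesgue_measure R).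
Variables (j a : R).
Hypotheses (j0 : 0 < j) (a2 : a * a = 1).

Definition expclock (u : R) : R := j * a * (expR (a * u) - 1).

Lemma is_derive_expclock (u : R) : is_derive u 1 expclock (j * expR (a * u)).
Proof.
rewrite /expclock; apply: is_derive_eq.
rewrite /GRing.scale/=.
by rewrite subr0 mulr1 [expR _ * a]mulrC mulrA -(mulrA j) a2 mulr1.
Qed.

Lemma continuous_derive_expclock : continuous (fun u => j * expR (a * u)).
Proof.
move=> u; apply: cvgM; first exact: cvg_cst.
apply: continuous_cvg; first exact: continuous_expR.
by apply: cvgM; [exact: cvg_cst|exact: cvg_id].
Qed.

Lemma integral_expclock (u : R) : 0 <= u ->
  (\int[mu]_(v in `[0%R, u]) (j * expR (a * v))%:E = (expclock u)%:E)%E.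
Proof.
rewrite le_eqVlt => /predU1P[<-|u0].
  by rewrite set_itv1 integral_set1 /expclock mulr0 expR0 subrr mulr0.
have dE v : derivable expclock v 1 by have [] := is_derive_expclock v.
have cE : continuous expclock.
  by move=> v; apply: differentiable_continuous; apply/derivable1_diffP.
rewrite (@continuous_FTC2 _ _ expclock).
- by rewrite /expclock !mulr0 expR0 subrr mulr0 sube0.
- exact: u0.
- exact/continuous_subspaceT/continuous_derive_expclock.
- split => //.
  + by apply: cvg_at_right_filter; exact: cE.
  + by apply: cvg_at_left_filter; exact: cE.
- by move=> v _; rewrite derive1E; have [_ ->] := is_derive_expclock v.
Qed.

Lemma expclock_mono : {homo expclock : u v / u < v}.
Proof.
have [a1|a1] : a = 1 \/ a = -1.
  have /eqP : (a - 1) * (a + 1) = 0 by rewrite mulrDr mulr1 mulrBl a2 mul1r; ring.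
  by rewrite mulf_eq0 subr_eq0 addr_eq0 => /orP[] /eqP ->; [left|right].
- by move=> u v uv; rewrite /expclock a1 mulr1 ltr_pM2l// ltrD2r ltr_expR !mul1r.
- move=> u v uv; rewrite /expclock a1 mulrN mulr1 !mulNr ltrN2 ltr_pM2l// ltrD2r ltr_expR.
  by rewrite !mul1r ltrN2.
Qed.

Lemma expclock_subst (L : \bar R) (h : R -> \bar R) :
  (forall u, 0 <= u -> ((expclock u)%:E < L)%E) ->
  (forall c, 0 <= c -> (c%:E < L)%E -> exists2 u, 0 <= u & c <= expclock u) ->
  measurable_fun setT h -> (forall c, 0 <= h c)%E ->
  (\int[mu]_(v in `[0%R, +oo[) (h (expclock v) * (j * expR (a * v))%:E) =
   \int[mu]_(c in [set c | (0 <= c)%R /\ c%:E < L]) h c)%E.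
Proof.
move=> EL LE mh h0; apply: integral_subst => //.
- apply: nondecreasing_measurable => // u v; rewrite le_eqVlt => /predU1P[->//|uv].
  exact/ltW/expclock_mono.
- exact: continuous_measurable_fun continuous_derive_expclock.
- by move=> v; rewrite mulr_ge0 ?expR_ge0// ltW.
- exact: integral_expclock.
- by move=> u v _ _; exact: expclock_mono.
Qed.

End exp_subst.

(** The absolute value lets the inverse be written as the power -1, which is measurable on the whole
    line. Where such factors carry weight their argument is positive, so the absolute value changes
    nothing. *)
Lemma measurable_normV (R : realType) d (T : measurableType d) (D : set T) (f : T -> R) :
  measurable_fun D f -> measurable_fun D (fun t => `|f t|^-1).
Proof.
move=> mf; rewrite (_ : (fun _ => _) = (fun t => `|f t| `^ -1)).
  apply: (measurableT_comp (f := fun z : R => z `^ (-1))).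
    exact: measurable_powR.
  exact: measurableT_comp.
by apply/funext => t; rewrite powR_inv1.
Qed.

(** * The two substitutions along a single path *)

Section path_subst.
Context (R : realType).
Local Notation mu := (@lebesgue_measure R).
Variables (al j : R).
Hypotheses (al0 : 0 < al) (j0 : 0 < j).
Variable psi : R * R -> \bar R.
Hypotheses (mpsi : measurable_fun setT psi) (psi0 : forall p, (0 <= psi p)%E).
Variable y : R -> R.
Hypothesis ry : rcll y.

(** Lamperti's formula for a path that is never killed. When the path tends to +oo the time change
    is finite, so [fine] reads its true value. *)
Definition pssmp_path (t x : R) (y : R -> R) : R :=
  x * expR (y (fine (time_change al (EFin \o y) (t * x `^ (- al))))).

Definition flow (v x : R) (y : R -> R) : R :=
  expR v `^ (- al^-1) * pssmp_path (expR v - 1) x y.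

(** The starting point j^(-1/al) is chosen so that time e^v - 1 corresponds to the clock level j
    (e^v - 1), the variable of [expclock]. *)
Lemma flowE (v : R) : flow v (j `^ (- al^-1)) y = (j * expR v) `^ (- al^-1) *
  expR (y (fine (time_change al (EFin \o y) (j * (expR v - 1))))).
Proof.
have p1 : (j `^ (- al^-1)) `^ (- al) = j.
  have -> : (j `^ (- al^-1)) `^ (- al) = j `^ (- al^-1 * - al) by rewrite powRrM.
  have -> : - al^-1 * - al = 1 by rewrite mulrNN mulVf// gt_eqF.
  by rewrite powRr1// ltW.
have p2 : (j * expR v) `^ (- al^-1) = j `^ (- al^-1) * expR v `^ (- al^-1).
  by rewrite powRM ?expR_ge0// ltW.
by rewrite /flow /pssmp_path p2 p1 mulrA [expR v `^ _ * _]mulrC [j * (_ - _)]mulrC.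
Qed.

(** Both sides are pulled back from one integral over the clock level c, by c = j (e^v - 1) on the
    left and c = A_u on the right. As y tends to +oo, both substitutions sweep the whole
    half-line. *)
Lemma flow_subst : y t @[t --> +oo] --> +oo ->
  (\int[mu]_(v in `[0%R, +oo[) psi (v, flow v (j `^ (- al^-1)) y)%R =
   \int[mu]_(u in `[0%R, +oo[)
     (psi (ln (1 + clock al y u / j), (j + clock al y u) `^ (- al^-1) * expR (y u))%R *
      (expR (al * y u) / (j + clock al y u))%R%:E))%E.
Proof.
move=> yoo.
(* The last factor, 1/(j + c), is dv/dc. *)
pose h c := (psi (ln (1 + c / j), (j + c) `^ (- al^-1) *
  expR (y (fine (time_change al (EFin \o y) c))))%R * (`|j + c|^-1)%R%:E)%E.
have my : measurable_fun setT y by apply: right_cts_measurable1 => t; have [] := ry t.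
have mtc : measurable_fun setT (time_change al (EFin \o y)).
  apply: (@measurable_time_change _ _ R al id (fun=> EFin \o y)) => //.
  move=> _; apply/measurable_EFinP; apply: measurable_funTS; exact: measurable_expR_path.
have mh : measurable_fun setT h.
  apply: emeasurable_funM; last first.
    apply/measurable_EFinP; apply: measurable_normV.
    exact: measurable_funD.
  apply: (measurableT_comp mpsi); apply: measurable_fun_pair.
    apply: measurableT_comp; first exact: measurable_ln.
    by apply: measurable_funD => //; apply: measurable_funM.
  apply: measurable_funM.
    apply: (measurableT_comp (f := fun z : R => z `^ (- al^-1))).
      exact: measurable_powR.
    by apply: measurable_funD.
  do 2 apply: measurableT_comp => //.
  exact: (measurableT_comp (fine_measurable _)).
have h0 c : (0 <= h c)%E by rewrite mule_ge0// lee_fin invr_ge0.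
have setE : [set c | 0 <= c /\ (c%:E < +oo)%E] = `[0, +oo[%classic :> set R.
  by apply/seteqP; split => c /=; rewrite in_itv/= andbT ?ltry => // -[].
have jE v : j + expclock j 1 v = j * expR v by rewrite /expclock mul1r; ring.
transitivity (\int[mu]_(c in `[0%R, +oo[) h c)%E.
  rewrite -[in RHS]setE -[RHS](expclock_subst j0 (mulr1 1) _ _ mh h0); last 2 first.
  - by move=> u _; rewrite ltry.
  - move=> c c0 _; have cj : 0 < 1 + c / j by rewrite ltr_wpDr ?divr_ge0// ltW.
    exists (ln (1 + c / j)).
      by apply: ln_ge0; rewrite lerDl divr_ge0// ltW.
    rewrite /expclock mul1r lnK ?posrE// mulr1 addrAC subrr add0r mulrC divfK//.
    by rewrite gt_eqF.
  apply: eq_integral => v _; rewrite /h jE mul1r.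
  have jv0 : 0 < j * expR v by rewrite mulr_gt0 ?expR_gt0.
  have -> : 1 + expclock j 1 v / j = expR v.
    rewrite (_ : expclock _ _ _ = j * expR v - j); last by rewrite -jE; ring.
    by rewrite mulrBl mulrAC mulfV ?gt_eqF// mul1r addrC subrK.
  rewrite expRK gtr0_norm// -muleA -EFinM mulVf ?gt_eqF// mule1.
  have -> : expclock j 1 v = j * (expR v - 1) by rewrite /expclock mulr1 mul1r.
  by rewrite flowE.
rewrite -[in LHS]setE -[in LHS](clock_total al0 ry yoo) -[LHS](clock_subst al ry mh h0).
apply: eq_integral => u; rewrite inE/= in_itv/= andbT => u0.
rewrite /h time_change_clock//= -muleA -EFinM gtr0_norm; last first.
  by rewrite ltr_wpDr// clock_ge0.
by rewrite [X in _ = (_ * X%:E)%E]mulrC.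
Qed.

(** The same scheme with c = j (1 - e^(-v)) and c = B_u. Now c stays in [0, j[, and B_u < j is
    strict because the clock still grows after u. *)
Lemma age_subst (phi : R -> \bar R) :
  measurable_fun setT phi -> (forall v, 0 <= phi v)%E ->
  (\int[mu]_(r in `[0%R, +oo[) (expR (- al * y r))%:E = j%:E)%E ->
  (forall u, 0 <= u -> clock (- al) y u < j) /\
  (\int[mu]_(v in `[0%R, +oo[) phi v =
   \int[mu]_(u in `[0%R, +oo[)
     (phi (ln (1 + clock (- al) y u / (j - clock (- al) y u)))%R *
      (expR (- al * y u) / (j - clock (- al) y u))%R%:E))%E.
Proof.
move=> mphi phi0 yj.
have Bj u : 0 <= u -> clock (- al) y u < j.
  move=> u0; apply: (@lt_le_trans _ _ (clock (- al) y (u + 1))).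
    by apply: clock_mono => //; rewrite ?in_itv/= ?andbT ?addr_ge0// ltrDl.
  rewrite -lee_fin -clockE// -yj; apply: ge0_subset_integral => //.
    apply/measurable_EFinP; apply: measurable_funTS; exact: measurable_expR_path.
  by apply: subset_itvl; rewrite bnd_simp.
split => //.
pose h (c : R) := (phi (ln (1 + c * `|j - c|^-1))%R * (`|j - c|^-1)%R%:E)%E.
have mjc : measurable_fun setT (fun c : R => `|j - c|^-1).
  by apply: measurable_normV; apply: measurable_funB.
have mh : measurable_fun setT h.
  apply: emeasurable_funM; last exact/measurable_EFinP.
  apply: measurableT_comp => //; apply: measurableT_comp; first exact: measurable_ln.
  by apply: measurable_funD => //; apply: measurable_funM.
have h0 c : (0 <= h c)%E by rewrite mule_ge0// lee_fin invr_ge0.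
have jE v : j - expclock j (- 1) v = j * expR (- v).
  by rewrite /expclock mulN1r; ring.
transitivity (\int[mu]_(c in [set c | (0 <= c)%R /\ c%:E < j%:E]) h c)%E.
  have a2 : -1 * -1 = 1 :> R by rewrite mulrNN mulr1.
  rewrite -[RHS](expclock_subst j0 a2 _ _ mh h0); last 2 first.
  - by move=> u _; rewrite lte_fin -subr_gt0 jE mulr_gt0 ?expR_gt0.
  - move=> c c0; rewrite lte_fin => cj; have cj0 : 0 < 1 - c / j.
      by rewrite subr_gt0 ltr_pdivrMr// mul1r.
    exists (- ln (1 - c / j)).
      by rewrite oppr_ge0; apply: ln_le0; rewrite gerBl divr_ge0// ltW.
    rewrite /expclock mulrNN mul1r lnK ?posrE// mulrN1 mulNr.
    by rewrite [1 - _]addrC addrK mulrN opprK mulrC divfK// gt_eqF.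
  apply: eq_integral => v _; rewrite /h jE mulN1r.
  have jv0 : 0 < j * expR (- v) by rewrite mulr_gt0 ?expR_gt0.
  have -> : 1 + expclock j (- 1) v * `|j * expR (- v)|^-1 = expR v.
    rewrite (_ : expclock _ _ _ = j - j * expR (- v)); last by rewrite -jE; ring.
    rewrite gtr0_norm// mulrBl mulfV ?gt_eqF// invfM expRN invrK.
    by rewrite mulrA mulfV ?gt_eqF// mul1r addrC subrK.
  by rewrite expRK gtr0_norm// -muleA -EFinM mulVf ?gt_eqF// mule1.
rewrite -yj -[LHS](clock_subst (- al) ry mh h0).
apply: eq_integral => u; rewrite inE/= in_itv/= andbT => u0.
rewrite /h -muleA -EFinM gtr0_norm ?subr_gt0 ?Bj//.
by rewrite [X in _ = (_ * X%:E)%E]mulrC.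
Qed.

End path_subst.

(** * Reversal of a Levy path at a fixed time *)

Section grid_law.
Context (R : realType) (u : R).

(** The point of index 2^m is u, so reversal at u maps the grid points of [0, u] onto themselves.
    The grid continues past u, where the independent copy takes over. *)
Definition grid (m k : nat) : R := u / 2 ^+ m * k%:R.

Definition ginc (m k : nat) (f : R -> R) : R := f (grid m k.+1) - f (grid m k).

Definition grid_rect (m : nat) : set (set (R -> R)) :=
  [set A | exists (n : nat) (B : nat -> set R), (forall i, measurable (B i)) /\
    A = [set f | forall i, (i < n)%N -> B i (ginc m i f)]].

(* Increments on dyadic fractions of u determine everything that is needed of a path,
   and their laws are products; the full path sigma-algebra is never used. *)
Definition grid_events : set (set (R -> R)) := \bigcup_m <<s grid_rect m >>.

Lemma grid_rect_setI m : setI_closed (grid_rect m).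
Proof.
move=> _ _ [n [B [mB ->]]] [n' [B' [mB' ->]]].
exists (maxn n n'), (fun i => (if (i < n)%N then B i else setT) `&`
                              (if (i < n')%N then B' i else setT)); split.
  by move=> i; apply: measurableI; case: ifP.
apply/seteqP; split => f /=.
  move=> [Bf B'f] i _; split; case: ifPn => // ni; [exact: Bf|exact: B'f].
move=> H; split => i ni; have := H i; rewrite leq_max ni ?orbT => /(_ isT)[].
  by [].
by [].
Qed.

Lemma measurable_ginc_same m i :
  measurable_fun setT (ginc m i : g_sigma_algebraType (grid_rect m) -> R).
Proof.
move=> _ B mB; rewrite setTI; apply: sub_sigma_algebra.
exists i.+1, (fun k => if k == i then B else setT); split.
  by move=> k; case: ifP.
apply/seteqP; split => f /= Bf.
  by move=> k _; case: eqP => // ->.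
by have := Bf i; rewrite eqxx; apply.
Qed.

Lemma gridS m k : grid m.+1 k.*2 = grid m k.
Proof.
by rewrite /grid -muln2 natrM exprS; field; rewrite expf_neq0.
Qed.

Lemma gincS m i f : ginc m i f = ginc m.+1 i.*2 f + ginc m.+1 i.*2.+1 f.
Proof. by rewrite /ginc -doubleS !gridS; ring. Qed.

(** A coarse increment is a sum of two finer ones, so a coarse rectangle is in general not a finer
    rectangle but belongs to the sigma-algebra of the finer ones. Hence [grid_events] collects whole
    sigma-algebras, and their monotonicity makes the union stable under intersection. *)
Lemma grid_rect_sub m m' : (m <= m')%N -> <<s grid_rect m >> `<=` <<s grid_rect m' >>.
Proof.
elim: m' => [|m' IH]; first by rewrite leqn0 => /eqP ->.
rewrite leq_eqVlt => /predU1P[->//|]; rewrite ltnS => /IH/subset_trans; apply.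
apply: smallest_sub; first exact: smallest_sigma_algebra.
move=> _ [n [B [mB ->]]].
pose E : measurableType _ := g_sigma_algebraType (grid_rect m'.+1).
suff : @measurable _ E [set f | forall i, (i < n)%N -> B i (ginc m' i f)] by [].
rewrite (_ : [set f | _] = \bigcap_(i in `I_n) (ginc m' i @^-1` B i)); last first.
  by apply/seteqP; split => f /= H i ni; exact: H.
apply: bigcap_measurableType => i _; rewrite -[X in measurable X]setTI.
have mi : measurable_fun setT (ginc m' i : E -> R).
  rewrite (_ : ginc m' i = ginc m'.+1 i.*2 \+ ginc m'.+1 i.*2.+1); last first.
    by apply/funext => f; exact: gincS.
  by apply: measurable_funD; exact: measurable_ginc_same.
exact: mi.
Qed.

Lemma grid_events_setI : setI_closed grid_events.
Proof.
move=> A B [m _ mA] [m' _ mB]; exists (maxn m m') => //.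
pose E : measurableType _ := g_sigma_algebraType (grid_rect (maxn m m')).
apply: (@measurableI _ E).
  by apply: grid_rect_sub mA; rewrite leq_maxl.
by apply: grid_rect_sub mB; rewrite leq_maxr.
Qed.

Definition gpath : Type := g_sigma_algebraType grid_events.
HB.instance Definition _ := Measurable.on gpath.

Lemma measurable_ginc m i : measurable_fun setT (ginc m i : gpath -> R).
Proof.
move=> _ B mB; rewrite setTI; apply: sub_sigma_algebra; exists m => //.
by rewrite -[X in <<s _ >> X]setTI; exact: measurable_ginc_same.
Qed.

End grid_law.

(** * Image laws determined on an intersection-stable family *)

Section dynkin_transport.
Context (R : realType) d1 (T1 : measurableType d1) d2 (T2 : measurableType d2).
Variables (P1 : {measure set T1 -> \bar R}) (P2 : {measure set T2 -> \bar R}).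
Hypothesis P1fin : (P1 setT < +oo)%E.
Context (E : pointedType) (G : set (set E)).
Variables (phi1 : T1 -> E) (phi2 : T2 -> E).
Hypotheses (GI : setI_closed G) (GT : G setT).
Hypotheses (m1 : forall A, G A -> measurable (phi1 @^-1` A))
  (m2 : forall A, G A -> measurable (phi2 @^-1` A)).
Hypothesis (P12 : forall A, G A -> P1 (phi1 @^-1` A) = P2 (phi2 @^-1` A)).

Lemma generated_measurable1 A : <<s G >> A -> measurable (phi1 @^-1` A).
Proof.
move=> GA; have mphi : measurable_fun setT (phi1 : T1 -> g_sigma_algebraType G).
  apply: (@measurability _ _ _ (g_sigma_algebraType G) setT _ G) => // _ [B GB <-].
  by rewrite setTI; exact: m1.
by rewrite -[X in measurable X]setTI; exact: mphi.
Qed.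

Lemma generated_law A : <<s G >> A -> P1 (phi1 @^-1` A) = P2 (phi2 @^-1` A).
Proof.
have mphi1 : measurable_fun setT (phi1 : T1 -> g_sigma_algebraType G).
  apply: (@measurability _ _ _ (g_sigma_algebraType G) setT _ G) => // _ [B GB <-].
  by rewrite setTI; exact: m1.
have mphi2 : measurable_fun setT (phi2 : T2 -> g_sigma_algebraType G).
  apply: (@measurability _ _ _ (g_sigma_algebraType G) setT _ G) => // _ [B GB <-].
  by rewrite setTI; exact: m2.
pose nu1 : {measure set (g_sigma_algebraType G) -> \bar R} :=
  pushforward P1 (phi1 : T1 -> g_sigma_algebraType G).
pose nu2 : {measure set (g_sigma_algebraType G) -> \bar R} :=
  pushforward P2 (phi2 : T2 -> g_sigma_algebraType G).
move=> GA; suff : nu1 mphi1 A = nu2 mphi2 A by [].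
apply: (@g_sigma_algebra_measure_unique _ R (g_sigma_algebraType G) G _ (fun=> setT)) => //.
- by move=> B GB; exact: sub_sigma_algebra.
- by rewrite bigcup_const//; exists 0%N.
Qed.

End dynkin_transport.

Section grid_transfer.
Context (R : realType) d1 (T1 : measurableType d1) d2 (T2 : measurableType d2).
Variables (P1 : {measure set T1 -> \bar R}) (P2 : {measure set T2 -> \bar R}).
Hypothesis P1fin : (P1 setT < +oo)%E.
Variable u : R.
Variables (phi1 : T1 -> R -> R) (phi2 : T2 -> R -> R).
Hypotheses (m1 : forall m i, measurable_fun setT (fun w => ginc u m i (phi1 w)))
  (m2 : forall m i, measurable_fun setT (fun w => ginc u m i (phi2 w))).
Hypothesis P12 : forall m n (B : nat -> set R), (forall i, measurable (B i)) ->
  P1 [set w | forall i, (i < n)%N -> B i (ginc u m i (phi1 w))] =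
  P2 [set w | forall i, (i < n)%N -> B i (ginc u m i (phi2 w))].

Let mrect d (T : measurableType d) (phi : T -> R -> R) m A :
  (forall m i, measurable_fun setT (fun w => ginc u m i (phi w))) ->
  grid_rect u m A -> measurable (phi @^-1` A).
Proof.
move=> mphi [n [B [mB ->]]].
rewrite (_ : _ @^-1` _ =
    \bigcap_(i in `I_n) ((fun w => ginc u m i (phi w)) @^-1` B i)); last first.
  by apply/seteqP; split => f /= H i ni; exact: H.
apply: bigcap_measurableType => i _; rewrite -[X in measurable X]setTI.
exact: mphi.
Qed.

Let rectT m : grid_rect u m setT.
Proof. by exists 0%N, (fun=> setT); split => //; apply/seteqP; split. Qed.

Let mev d (T : measurableType d) (phi : T -> R -> R) A :
  (forall m i, measurable_fun setT (fun w => ginc u m i (phi w))) ->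
  grid_events u A -> measurable (phi @^-1` A).
Proof.
by move=> mphi [m _]; apply: generated_measurable1 => B; exact: mrect.
Qed.

Let mphi d (T : measurableType d) (phi : T -> R -> R) :
  (forall m i, measurable_fun setT (fun w => ginc u m i (phi w))) ->
  measurable_fun setT (phi : T -> gpath u).
Proof.
move=> mphi; apply: (@measurability _ _ _ (gpath u) setT _ (grid_events u)) => //.
by move=> _ [B GB <-]; rewrite setTI; exact: mev.
Qed.

Lemma integral_grid_transfer (Theta : gpath u -> \bar R) :
  measurable_fun setT Theta -> (forall f, 0 <= Theta f)%E ->
  (\int[P1]_w Theta (phi1 w) = \int[P2]_w Theta (phi2 w))%E.
Proof.
move=> mT T0.
(* The uniqueness argument is applied twice: from rectangles to the sigma-algebra of one level, then
   from the union of all levels to what it generates. *)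
have H A : @measurable _ (gpath u) A -> P1 (phi1 @^-1` A) = P2 (phi2 @^-1` A).
  apply: generated_law => //.
  - exact: grid_events_setI.
  - by exists 0%N => //; apply: sub_sigma_algebra; exact: rectT.
  - by move=> B; exact: mev.
  - by move=> B; exact: mev.
  - move=> B [m _]; apply: generated_law => //.
    + exact: grid_rect_setI.
    + by move=> C; exact: mrect.
    + by move=> C; exact: mrect.
    + by move=> _ [n [C [mC ->]]]; exact: P12.
have E1 := @ge0_integral_pushforward _ _ _ _ _ _ (mphi m1) P1 setT Theta measurableT mT (fun y _ => T0 y).
have E2 := @ge0_integral_pushforward _ _ _ _ _ _ (mphi m2) P2 setT Theta measurableT mT (fun y _ => T0 y).
rewrite !preimage_setT in E1 E2; rewrite -[LHS]E1 -[RHS]E2.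
by apply: eq_measure_integral; [exact: mphi|exact: mphi|move=> ? ? A mA _; exact: H].
Qed.

End grid_transfer.

(** * Reversed and concatenated Levy paths *)

Section levy_paths.
Context (R : realType) d (W : measurableType d) (Q : probability W R).
Variable Y : R -> W -> R.
Hypothesis hY : levy Q Y.
Local Notation mu := (@lebesgue_measure R).

(** Frozen before time 0 and recentred at its initial value: every path, not merely almost every
    one, is then [rcll] and vanishes at 0, while increments at nonnegative times are unchanged. *)
Definition lpath (Y : R -> W -> R) (w : W) (t : R) : R := Y (Num.max 0 t) w - Y 0 w.

Local Notation y := (lpath Y).

Lemma rcll_lpath w : rcll (y w).
Proof. exact: rcll_cadlag (levy_cadlag hY w). Qed.

Lemma lpath0 w : y w 0 = 0.
Proof. by rewrite /lpath maxxx subrr. Qed.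

Lemma measurable_lpath t : measurable_fun setT (fun w => y w t).
Proof.
apply: measurable_funB; apply: (levy_measurable hY) => //.
by rewrite le_max lexx.
Qed.

Lemma measurable_lpath2 : measurable_fun setT (fun p : R * W => y p.2 p.1).
Proof.
apply: (right_cts_measurable (Z := fun t w => y w t)) => [|t w].
  exact: measurable_lpath.
by have [] := rcll_lpath w t.
Qed.

Lemma lpathB s t w : 0 <= s -> 0 <= t -> y w t - y w s = Y t w - Y s w.
Proof. by move=> s0 t0; rewrite /lpath !max_r//; ring. Qed.

Variable u : R.
Hypothesis u0 : 0 < u.

Let grid_ge0 m k : 0 <= grid u m k.
Proof. by rewrite /grid mulr_ge0// divr_ge0 ?exprn_ge0// ltW. Qed.

Lemma gridD m i k : grid u m (i + k) = grid u m i + grid u m k.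
Proof. by rewrite /grid natrD mulrDr. Qed.

Lemma grid_end m : grid u m (2 ^ m) = u.
Proof. by rewrite /grid natrX mulfVK// expf_neq0. Qed.

Lemma grid_le m i k : (grid u m i <= grid u m k) = (i <= k)%N.
Proof. by rewrite /grid ler_pM2l ?ler_nat// divr_gt0 ?exprn_gt0. Qed.

Let nu m (B : set R) := Q [set w | B (Y (u / 2 ^+ m) w)].

(** The mesh is uniform, so the increments on one grid are independent with the common law [nu m];
    rearranging them leaves the product unchanged. *)
Lemma levy_rect m n (B : nat -> set R) : (forall i, measurable (B i)) ->
  Q [set w | forall i, (i < n)%N -> B i (ginc u m i (y w))] =
  (\prod_(i < n) nu m (B i))%E.
Proof.
move=> mB.
have gi i w : ginc u m i (y w) = Y (grid u m i.+1) w - Y (grid u m i) w.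
  by rewrite /ginc lpathB.
have h0 : 0 <= u / 2 ^+ m by rewrite divr_ge0 ?exprn_ge0// ltW.
transitivity (Q (\bigcap_(i in `I_n)
    [set w | B i (Y (grid u m i.+1) w - Y (grid u m i) w)])).
  by congr (Q _); apply/seteqP; split => w /= H i ni; have := H i ni; rewrite gi.
rewrite (levy_independent hY)//; last by move=> i; rewrite grid_le.
apply: eq_bigr => i _.
have -> : grid u m i.+1 = grid u m i + u / 2 ^+ m.
  by rewrite -addn1 gridD; congr (_ + _); rewrite /grid mulr1.
exact: (levy_stationary hY).
Qed.

(* The path p.2 reversed on [0, u], followed by the independent path p.1. *)
Definition concat_path (p : W * W) (r : R) : R :=
  if r <= u then y p.2 u - y p.2 (u - r) else y p.2 u + y p.1 (r - u).

Lemma concat_path_low m i p : (i <= 2 ^ m)%N ->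
  concat_path p (grid u m i) = y p.2 u - y p.2 (grid u m (2 ^ m - i)).
Proof.
move=> im; have E : grid u m i + grid u m (2 ^ m - i) = u.
  by rewrite -gridD subnKC// grid_end.
rewrite /concat_path ifT; last by rewrite -[leRHS](grid_end m) grid_le.
by congr (_ - y _ _); rewrite -[X in X - _]E addrC addKr.
Qed.

Lemma concat_path_high m i p :
  concat_path p (grid u m (2 ^ m + i)) = y p.2 u + y p.1 (grid u m i).
Proof.
rewrite gridD grid_end /concat_path gerDl; case: ifPn => [i0|_]; last first.
  by rewrite [u + _ - u]addrAC subrr add0r.
have -> : grid u m i = 0 by apply/eqP; rewrite eq_le i0 grid_ge0.
by rewrite addr0 subrr !lpath0 subr0 addr0.
Qed.

Lemma ginc_concat_path_low m i p : (i < 2 ^ m)%N ->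
  ginc u m i (concat_path p) = ginc u m (2 ^ m - i.+1) (y p.2).
Proof.
move=> im; rewrite /ginc !concat_path_low//; last exact: ltnW.
by rewrite -subSn// subSS; ring.
Qed.

Lemma ginc_concat_path_high m i p : ginc u m (2 ^ m + i) (concat_path p) = ginc u m i (y p.1).
Proof. by rewrite /ginc -addnS !concat_path_high; ring. Qed.

Lemma measurable_ginc_lpath m i : measurable_fun setT (fun w => ginc u m i (y w)).
Proof. by apply: measurable_funB; exact: measurable_lpath. Qed.

Lemma measurable_ginc_concat_path m i : measurable_fun setT (fun p => ginc u m i (concat_path p)).
Proof.
have [im|im] := ltnP i (2 ^ m).
  under eq_fun do rewrite ginc_concat_path_low//.
  exact: (measurableT_comp (measurable_ginc_lpath m _) measurable_snd).
rewrite (_ : (fun p => _) = (fun p => ginc u m (i - 2 ^ m) (y p.1))); last first.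
  by apply/funext => p; rewrite -[in LHS](subnKC im) ginc_concat_path_high.
exact: (measurableT_comp (measurable_ginc_lpath m _) measurable_fst).
Qed.

(** On the grid, the increments of the concatenated path are the first 2^m of p.2 in reverse order
    and with the same sign, followed by those of p.1. They are again independent with law [nu m]. *)
Lemma concat_path_rect m n (B : nat -> set R) : (forall i, measurable (B i)) ->
  (Q \x Q)%E [set p | forall i, (i < n)%N -> B i (ginc u m i (concat_path p))] =
  Q [set w | forall i, (i < n)%N -> B i (ginc u m i (y w))].
Proof.
(* Padding with [setT] up to 2^m + n lets the constraints split at index 2^m, whatever n is. *)
move=> mB; pose B' i := if (i < n)%N then B i else setT.
have mB' i : measurable (B' i) by rewrite /B'; case: ifP.
pose N := (2 ^ m + n)%N.
have extend T (phi : T -> R -> R) :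
    [set p | forall i, (i < n)%N -> B i (ginc u m i (phi p))] =
    [set p | forall i, (i < N)%N -> B' i (ginc u m i (phi p))].
  apply/seteqP; split => p /= H i ni; have := H i.
    by rewrite /B'; case: ifP => // ? /(_ isT).
  by rewrite /B' ni (leq_trans ni (leq_addl _ _)) => /(_ isT).
rewrite !extend levy_rect// [in RHS]big_split_ord/=.
have rectE : [set p | forall i, (i < N)%N -> B' i (ginc u m i (concat_path p))] =
    [set w | forall i, (i < n)%N -> B' (2 ^ m + i)%N (ginc u m i (y w))] `*`
    [set w | forall i, (i < 2 ^ m)%N -> B' (2 ^ m - i.+1)%N (ginc u m i (y w))].
  apply/seteqP; split => [p /= H|p /= [H1 H2] i iN].
    split => i ni.
      by have := H (2 ^ m + i)%N; rewrite ltn_add2l ginc_concat_path_high; apply.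
    have im : (2 ^ m - i.+1 < 2 ^ m)%N by rewrite ltn_subrL/= expn_gt0.
    have := H (2 ^ m - i.+1)%N; rewrite ginc_concat_path_low//.
    rewrite (_ : (2 ^ m - (2 ^ m - i.+1).+1)%N = i); last first.
      by rewrite -subSn// subSS subKn// ltnW.
    by apply; rewrite (leq_trans im)// leq_addr.
  have [im|im] := ltnP i (2 ^ m).
    rewrite ginc_concat_path_low//.
    have jm : (2 ^ m - i.+1 < 2 ^ m)%N by rewrite ltn_subrL/= expn_gt0.
    have := H2 _ jm.
    rewrite (_ : (2 ^ m - (2 ^ m - i.+1).+1)%N = i)//.
    by rewrite -subSn// subSS subKn// ltnW.
  rewrite -(subnKC im) ginc_concat_path_high; apply: H1.
  by rewrite ltn_subLR.
have mrect k (C : nat -> set R) : (forall i, measurable (C i)) ->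
    measurable [set w | forall i, (i < k)%N -> C i (ginc u m i (y w))].
  move=> mC; rewrite (_ : [set w | _] =
      \bigcap_(i in `I_k) ((fun w => ginc u m i (y w)) @^-1` C i)); last first.
    by apply/seteqP; split => f /= H i ni; exact: H.
  apply: bigcap_measurableType => i _; rewrite -[X in measurable X]setTI.
  exact: measurable_ginc_lpath.
rewrite rectE product_measure1E; last 2 first.
- by apply: (mrect n (fun i => B' (2 ^ m + i)%N)).
- by apply: (mrect (2 ^ m)%N (fun i => B' (2 ^ m - i.+1)%N)).
rewrite muleC; congr (_ * _)%E.
  apply: (etrans (@levy_rect m _ (fun i => B' (2 ^ m - i.+1)%N) _)) => //.
  rewrite (reindex_inj rev_ord_inj)/=; apply: eq_bigr => i _.
  by rewrite -subSn// subSS subKn// ltnW.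
exact: (@levy_rect m _ (fun i => B' (2 ^ m + i)%N)).
Qed.

Lemma integral_concat_path (Theta : gpath u -> \bar R) :
  measurable_fun setT Theta -> (forall f, 0 <= Theta f)%E ->
  (\int[Q \x Q]_p Theta (concat_path p) = \int[Q]_w Theta (y w))%E.
Proof.
move=> mT T0; apply: integral_grid_transfer => //.
- suff : ((Q \x Q)%E setT < +oo)%E by [].
  rewrite -setXTT product_measure1E//.
  have E : Q setT = 1%E by exact: probability_setT.
  by rewrite [X in (X * _)%E]E [X in (_ * X)%E]E mule1 ltry.
- exact: measurable_ginc_concat_path.
- exact: measurable_ginc_lpath.
- by move=> m n B; exact: concat_path_rect.
Qed.

End levy_paths.

(** * Exponential functionals as limits over the grid *)

Section transfer.
Context (R : realType) d (W : measurableType d) (Q : probability W R).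
Variable Y : R -> W -> R.
Hypothesis hY : levy Q Y.
Variables (al u : R).
Hypothesis u0 : 0 < u.
Local Notation mu := (@lebesgue_measure R).
Local Notation y := (lpath Y).

Lemma limn_esup_cvg (s : (\bar R)^nat) (l : \bar R) : s @ \oo --> l -> limn_esup s = l.
Proof.
move=> sl; rewrite is_cvg_limn_esupE; first exact: cvg_lim.
by apply/cvg_ex; exists l.
Qed.

(* Riemann sums are functions of the increments on the grid, so the upper limits [rint] and
   [rtot] are measurable for the grid events on arbitrary paths; along rcll paths they are
   the integrals themselves. *)
Definition rsum (m K : nat) (f : R -> R) : R :=
  \sum_(k < K) u / 2 ^+ m * expR (- al * (f (grid u m k) - f 0)).

Definition rint (N : nat) (f : R -> R) : \bar R :=
  limn_esup (fun m => (rsum m (N * 2 ^ m) f)%:E).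

Definition rtot (f : R -> R) : \bar R := limn_esup (fun N => rint N f).

Lemma sum_ginc m k f : \sum_(i < k) ginc u m i f = f (grid u m k) - f 0.
Proof.
elim: k => [|k IH]; first by rewrite big_ord0 /grid mulr0 subrr.
by rewrite big_ord_recr/= IH /ginc; ring.
Qed.

Lemma measurable_gval m k :
  measurable_fun setT (fun f : gpath u => f (grid u m k) - f 0).
Proof.
rewrite (_ : (fun f => _) = (fun f => \sum_(i < k) ginc u m i f)).
  by apply: measurable_sum => i; exact: measurable_ginc.
by apply/funext => f; rewrite sum_ginc.
Qed.

Lemma measurable_rint N : measurable_fun setT (rint N : gpath u -> \bar R).
Proof.
apply: measurable_fun_limn_esup => m; apply/measurable_EFinP.
apply: measurable_sum => k; apply: measurable_funM => //.
by do 2 apply: measurableT_comp => //; exact: measurable_gval.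
Qed.

Lemma measurable_rtot : measurable_fun setT (rtot : gpath u -> \bar R).
Proof. by apply: measurable_fun_limn_esup => m; exact: measurable_rint. Qed.

(** This is J. It is also the absorption time of the self-similar path that Lamperti's formula
    builds from -z and the starting point 1. *)
Definition lifespan (z : R -> R) : \bar R :=
  (\int[mu]_(r in `[0%R, +oo[) (expR (- al * z r))%:E)%E.

Lemma cvg_clock a z : rcll z ->
  ((clock a z (u * n%:R))%:E @[n --> \oo] -->
   \int[mu]_(r in `[0%R, +oo[) (expR (a * z r))%:E)%E.
Proof.
move=> rz.
have <- : \bigcup_n `[0%R, u * n%:R]%classic = `[0%R, +oo[%classic :> set R.
  apply/seteqP; split => [t [n _]/=|t]; rewrite /= !in_itv/= andbT; first by case/andP.
  move=> t0; exists (Num.truncn (t / u)).+1 => //=.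
  by rewrite in_itv/= t0 mulrC -ler_pdivrMr// ltW// truncnS_gt.
under eq_fun do rewrite -clockE//.
apply: ge0_nondecreasing_set_cvg_integral => //.
  move=> m n mn; rewrite subsetEset; apply: subset_itvl.
  by rewrite bnd_simp ler_pM2l// ler_nat.
by move=> n; apply/measurable_EFinP; apply: measurable_funTS; exact: measurable_expR_path.
Qed.

Lemma cvg_left a z N : rcll z ->
  ((\sum_(k < N * 2 ^ m) u / 2 ^+ m * expR (a * z (grid u m k)))%:E @[m --> \oo] -->
   (clock a z (u * N%:R))%:E)%E.
Proof.
move=> rz; rewrite -clockE//.
have [mM [_ H]] := expR_path_bounds a rz (u * N%:R + u).
apply: (riemann_left (g := fun r => expR (a * z r)) (M := mM.2)) => //.
- exact: measurable_expR_path.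
- by move=> r /H /andP[].
- exact: right_cts_expR_path.
Qed.

Lemma cvg_right a z N : rcll z ->
  ((\sum_(k < N * 2 ^ m) u / 2 ^+ m * expR (a * z (grid u m k.+1)))%:E @[m --> \oo] -->
   (clock a z (u * N%:R))%:E)%E.
Proof.
move=> rz; rewrite -clockE//.
have [mM [_ H]] := expR_path_bounds a rz (u * N%:R + u).
apply: (riemann_right (g := fun r => expR (a * z r)) (M := mM.2)) => //.
- exact: measurable_expR_path.
- by move=> r /H /andP[].
- exact: right_cts_expR_path.
Qed.

Lemma rint_lpath N w : rint N (y w) = (clock (- al) (y w) (u * N%:R))%:E.
Proof.
apply: limn_esup_cvg; have := @cvg_left (- al) _ N (rcll_lpath hY w).
apply: cvg_trans; apply: near_eq_cvg; apply: nearW => m.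
by congr EFin; apply: eq_bigr => k _; rewrite lpath0 subr0.
Qed.

Lemma rtot_lpath w : rtot (y w) = lifespan (y w).
Proof.
apply: limn_esup_cvg; under eq_fun do rewrite rint_lpath.
exact: cvg_clock (rcll_lpath hY w).
Qed.

Lemma concat_path0 p : concat_path Y u p 0 = 0.
Proof. by rewrite /concat_path (ltW u0) subr0 subrr. Qed.

(** The reversed part need not be right-continuous, so its Riemann sums are not treated as those of
    an [rcll] path. Reversal turns their left endpoints into right endpoints for p.2 and e^(-al y)
    into e^(-al y_u) e^(al y): the limit is A_u up to the factor. The N later blocks of length u
    give B for p.1 with the same factor. *)
Lemma rint_concat_path N p : rint N.+1 (concat_path Y u p) =
  ((expR (- al * y p.2 u))%:E *
   ((clock al (y p.2) u)%:E + (clock (- al) (y p.1) (u * N%:R))%:E))%E.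
Proof.
apply: limn_esup_cvg.
have c1 := @cvg_right al _ 1 (rcll_lpath hY p.2).
have c2 := @cvg_left (- al) _ N (rcll_lpath hY p.1).
rewrite mulr1 in c1.
rewrite (_ : (fun m => _) = (fun m => (expR (- al * y p.2 u))%:E *
  ((\sum_(k < 1 * 2 ^ m) u / 2 ^+ m * expR (al * y p.2 (grid u m k.+1)))%:E +
   (\sum_(k < N * 2 ^ m) u / 2 ^+ m * expR (- al * y p.1 (grid u m k)))%:E))%E).
  by apply: cvgeZl => //; apply: cvgeD.
apply/funext => m.
rewrite -EFinD -EFinM /rsum mulSn big_split_ord/= mul1n; congr EFin.
rewrite concat_path0 mulrDr !mulr_sumr; congr (_ + _); last first.
  by apply: eq_bigr => k _; rewrite concat_path_high// subr0 mulrDr expRD; ring.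
rewrite (reindex_inj rev_ord_inj)/=; apply: eq_bigr => k _.
rewrite (concat_path_low Y)// ?leq_subr// subr0 subKn//.
rewrite (_ : - al * (_ - _) = - al * y p.2 u + al * y p.2 (grid u m k.+1)); last by ring.
by rewrite expRD; ring.
Qed.

Lemma rtot_concat_path p : rtot (concat_path Y u p) =
  ((expR (- al * y p.2 u))%:E *
   ((clock al (y p.2) u)%:E + lifespan (y p.1)))%E.
Proof.
apply: limn_esup_cvg; rewrite -cvg_shiftS/=.
under eq_fun do rewrite rint_concat_path.
apply: cvgeZl => //; apply: cvgeD; first by rewrite fin_num_adde_defr.
  exact: cvg_cst.
exact: cvg_clock (rcll_lpath hY p.1).
Qed.

Lemma integral_transfer (H : \bar R * (R * R) -> \bar R) :
  measurable_fun setT H -> (forall z, 0 <= H z)%E ->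
  (\int[Q \x Q]_p
     H ((expR (- al * y p.2 u))%:E * ((clock al (y p.2) u)%:E + lifespan (y p.1)),
        (y p.2 u, expR (- al * y p.2 u) * clock al (y p.2) u)%R) =
   \int[Q]_w H (lifespan (y w), (y w u, clock (- al) (y w) u)))%E.
Proof.
move=> mH H0.
(* [grid u 0 1] is u itself, and [rint 1] integrates over the single block [0, u]; on a Levy path
   the arguments of H are therefore J, y_u and B_u. *)
pose Theta (f : gpath u) : \bar R :=
  H (rtot f, (f (grid u 0 1) - f 0, fine (rint 1 f))).
have u1 : grid u 0 1 = u by rewrite /grid expr0 divr1 mulr1.
have mT : measurable_fun setT Theta.
  apply: (measurableT_comp mH); apply: measurable_fun_pair; first exact: measurable_rtot.
  apply: measurable_fun_pair; first exact: measurable_gval.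
  by apply: measurableT_comp => //; exact: measurable_rint.
have := integral_concat_path hY u0 mT (fun f => H0 _).
have clock0 a z : clock a z 0 = 0 :> R.
  by rewrite /clock set_itv1 integral_set1.
move=> E; transitivity (\int[Q \x Q]_p Theta (concat_path Y u p))%E.
  apply: eq_integral => p _; rewrite /Theta u1 rtot_concat_path concat_path0 subr0 rint_concat_path.
  by rewrite mulr0 clock0 adde0 /= /concat_path lexx subrr lpath0 subr0.
rewrite E; apply: eq_integral => w _.
by rewrite /Theta u1 rtot_lpath rint_lpath lpath0 subr0 mulr1.
Qed.

End transfer.

(** * Stationarity integrated over time *)

Section halfline_fubini.
Context (R : realType) d (T : measurableType d) (m : {sigma_finite_measure set T -> \bar R}).
Local Notation mu := (@lebesgue_measure R).
Local Open Scope ereal_scope.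

Variables (f : R * T -> \bar R).
Hypotheses (mf : measurable_fun setT f) (f0 : forall z, 0 <= f z).

Let D : set R := `[0%R, +oo[%classic.
Let f' (z : R * T) := f z * (\1_D z.1)%:E.

Let mf' : measurable_fun setT f'.
Proof.
apply: emeasurable_funM => //; apply/measurable_EFinP.
apply: (measurableT_comp (f := \1_D : R -> R)) => //.
by apply: measurable_indic; exact: measurable_itv.
Qed.

Let f'0 z : 0 <= f' z.
Proof. by rewrite mule_ge0// lee_fin. Qed.

Let f'E t : \int[mu]_(v in `[0%R, +oo[) f (v, t) = \int[mu]_v f' (v, t).
Proof.
rewrite integral_mkcond; apply: eq_integral => v _.
by rewrite patchE /f' indicE /D/=; case: ifP; rewrite ?mule1 ?mule0.
Qed.

Lemma halfline_fubini :
  \int[mu]_(v in `[0%R, +oo[) \int[m]_t f (v, t) =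
  \int[m]_t \int[mu]_(v in `[0%R, +oo[) f (v, t).
Proof.
under [RHS]eq_integral do rewrite f'E.
transitivity (\int[mu]_v \int[m]_t f' (v, t)); last exact: (@fubini_tonelli _ _ _ _ R mu m f' mf' f'0).
rewrite integral_mkcond; apply: eq_integral => v _; rewrite patchE /f' /= indicE /D; case: ifP => vD.
  by apply: eq_integral => t _; rewrite mule1.
by rewrite integral0_eq// => t _; rewrite mule0.
Qed.

Lemma measurable_halfline_integral :
  measurable_fun setT (fun t => \int[mu]_(v in `[0%R, +oo[) f (v, t)).
Proof.
under eq_fun do rewrite f'E.
exact: (@measurable_fun_fubini_tonelli_G _ _ _ _ R mu f' mf' f'0).
Qed.

End halfline_fubini.

(** * Joint measurability of the path functionals *)

Section path_measurability.
Context (R : realType) d (W : measurableType d).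
Local Notation mu := (@lebesgue_measure R).
Variable y : W -> R -> R.
Hypothesis my : measurable_fun setT (fun p : R * W => y p.2 p.1).
Hypothesis ry : forall w, rcll (y w).
Context d' (T : measurableType d').

Lemma measurable_path_at (cu : T -> R) (cw : T -> W) :
  measurable_fun setT cu -> measurable_fun setT cw ->
  measurable_fun setT (fun t => y (cw t) (cu t)).
Proof. by move=> mu mw; exact: (measurableT_comp my (measurable_fun_pair mu mw)). Qed.

Variables (cx : T -> R) (cw : T -> W).
Hypothesis (mcx : measurable_fun setT cx).
Hypothesis (mcw : measurable_fun setT cw).

Let mexp (a : R) : measurable_fun setT (fun z : R * T => (expR (a * y (cw z.2) z.1))%:E).
Proof.
apply/measurable_EFinP; apply: measurableT_comp => //; apply: measurable_funM => //.
apply: (measurableT_comp my (measurable_fun_pair measurable_fst _)).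
exact: measurableT_comp mcw measurable_snd.
Qed.

Lemma measurable_lifespan (a : R) :
  measurable_fun setT (fun t => lifespan a (y (cw t))).
Proof.
apply: (@measurable_halfline_integral _ _ _
  (fun z : R * T => (expR (- a * y (cw z.2) z.1))%:E)) => //.
Qed.

Lemma measurable_clock_path (a : R) (cu : T -> R) : measurable_fun setT cu ->
  measurable_fun setT (fun t => clock a (y (cw t)) (cu t)).
Proof.
move=> mcu; apply: (measurableT_comp (f := fine)) => //.
(* The variable upper limit moves into an indicator, so that the domain of integration no longer
   depends on the parameter. *)
pose f (z : R * T) := ((expR (a * y (cw z.2) z.1))%:E * (\1_`]-oo, 0%R] (z.1 - cu z.2)%R)%:E)%E.
have mf : measurable_fun setT f.
  apply: emeasurable_funM => //; apply/measurable_EFinP.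
  apply: (measurableT_comp (f := \1_`]-oo, 0%R] : R -> R)).
    by apply: measurable_indic; exact: measurable_itv.
  by apply: measurable_funB => //; exact: measurableT_comp mcu measurable_snd.
have f0 z : (0 <= f z)%E by rewrite mule_ge0// lee_fin ?expR_ge0.
rewrite (_ : (fun t => _) = (fun t => \int[mu]_(r in `[0%R, +oo[) f (r, t))%E).
  exact: measurable_halfline_integral.
apply/funext => t; rewrite integral_mkcond [RHS]integral_mkcond.
apply: eq_integral => r _; rewrite !patchE /f/= indicE.
rewrite !mem_setE !in_itv/= andbT subr_le0; case: (0 <= r) => //=.
by case: (r <= _); rewrite ?mule1 ?mule0.
Qed.

Lemma measurable_pssmp_path (al : R) (ct : T -> R) : measurable_fun setT ct ->
  measurable_fun setT (fun t => pssmp_path al (ct t) (cx t) (y (cw t))).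
Proof.
move=> mct; apply: measurable_funM => //.
apply: measurableT_comp => //.
apply: (measurable_path_at (cw := cw) (cu := fun t =>
  fine (time_change al (EFin \o y (cw t)) (ct t * cx t `^ (- al))))) => //.
apply: (measurableT_comp (f := fine)) => //.
apply: (@measurable_time_change _ _ _ al
  (fun t => ct t * cx t `^ (- al)) (fun t => EFin \o y (cw t))).
- apply: measurable_funM => //.
  by apply: (measurableT_comp (f := fun z : R => z `^ (- al))).
- move=> t; apply/measurable_EFinP; apply: measurable_funTS.
  exact: measurable_expR_path.
- move=> q; rewrite (_ : (fun t => _) = (fun t => (clock al (y (cw t)) q)%:E)).
    by apply/measurable_EFinP; exact: measurable_clock_path.
  by apply/funext => t; rewrite -clockE.
Qed.

Lemma measurable_flow (al : R) (cv : T -> R) : measurable_fun setT cv ->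
  measurable_fun setT (fun t => flow al (cv t) (cx t) (y (cw t))).
Proof.
move=> mcv; have mE : measurable_fun setT (fun t => expR (cv t)) by exact: measurableT_comp.
apply: measurable_funM.
  by apply: (measurableT_comp (f := fun z : R => z `^ (- al^-1))).
by apply: measurable_pssmp_path; exact: measurable_funB.
Qed.

End path_measurability.

Section stationarity.
Context (R : realType) d (W : measurableType d) (Q : probability W R).
Variable Y : R -> W -> R.
Hypothesis hY : levy Q Y.
Variable al : R.
Hypothesis al0 : 0 < al.
Local Notation mu := (@lebesgue_measure R).
Local Notation y := (lpath Y).
Hypothesis yoo : {ae Q, forall w, y w t @[t --> +oo] --> +oo}.

Let my : measurable_fun setT (fun p : R * W => y p.2 p.1).
Proof. exact: measurable_lpath2 hY. Qed.
Let ry : forall w, rcll (y w).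
Proof. exact: rcll_lpath hY. Qed.

(* Junk value 0 when the integral is infinite; its inverse is then 0 as well, so such paths
   carry no weight and finiteness of the integral need not be proved. *)
Definition perpetuity (w : W) : R := fine (lifespan al (y w)).

Lemma lifespan_gt0 w : (0 < lifespan al (y w))%E.
Proof.
apply: (@lt_le_trans _ _ (clock (- al) (y w) 1)%:E).
  rewrite lte_fin (le_lt_trans (clock_ge0 (- al) (ry w) 0))//.
  by apply: clock_mono => //; rewrite in_itv/= ?andbT ?ler01 ?lexx.
rewrite -clockE//; apply: ge0_subset_integral => //.
  apply/measurable_EFinP; apply: measurable_funTS; exact: measurable_expR_path.
by apply: subset_itvl; rewrite bnd_simp.
Qed.

Variant perpetuity_spec : R -> \bar R -> Prop :=
  | PerpetuityInfinite : perpetuity_spec 0 +oo%E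
  | PerpetuityFinite j of 0 < j : perpetuity_spec j j%:E.

Lemma perpetuityP w : perpetuity_spec (perpetuity w) (lifespan al (y w)).
Proof.
rewrite /perpetuity; have := lifespan_gt0 w; case: (lifespan al (y w)) => [j||] //= j0.
  by constructor; rewrite -lte_fin.
by constructor.
Qed.

Lemma measurable_perpetuity d' (T : measurableType d') (cw : T -> W) :
  measurable_fun setT cw -> measurable_fun setT (fun t => perpetuity (cw t)).
Proof.
by move=> mcw; apply: (measurableT_comp (f := fine)) => //; exact: (measurable_lifespan my mcw al).
Qed.

Let mnorm d' (T : measurableType d') (f : T -> R) :
  measurable_fun setT f -> measurable_fun setT (fun t => f t `^ (- al^-1)).
Proof.
move=> mf; apply: (measurableT_comp (f := fun z : R => z `^ (- al^-1))) => //.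
Qed.

Variable psi : R * R -> \bar R.
Hypotheses (mpsi : measurable_fun setT psi) (psi0 : forall z, (0 <= psi z)%E).

(* [F] is the integrand in the variable v, [G] the same after e^v = 1 + A_u / J, and [H]
   the common form of both sides as a function of (J, y_u, B_u). *)
Let F (z : R * (W * W)) : \bar R :=
  ((`|perpetuity z.2.1|^-1)%R%:E *
    psi (z.1, flow al z.1 (perpetuity z.2.1 `^ (- al^-1)) (y z.2.2)))%E.

Let G1 (u j : R) (w : W) : \bar R :=
  let a := y w u in let A := clock al (y w) u in
  (psi (ln (1 + A * `|j|^-1), (j + A) `^ (- al^-1) * expR a)%R *
   (expR (al * a) * `|j + A|^-1)%R%:E)%E.

Let G (z : R * (W * W)) : \bar R :=
  ((`|perpetuity z.2.1|^-1)%R%:E * G1 z.1 (perpetuity z.2.1) z.2.2)%E.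

Let H (z : \bar R * (R * R)) : \bar R :=
  ((`|fine z.1|^-1 * `|fine z.1 - z.2.2|^-1 * expR (- al * z.2.1))%R%:E *
   psi (ln (1 + z.2.2 * `|fine z.1 - z.2.2|^-1), fine z.1 `^ (- al^-1))%R)%E.

Let m1 : measurable_fun setT (fun z : R * (W * W) => z.2.1).
Proof. exact: measurableT_comp measurable_fst measurable_snd. Qed.

Let m2 : measurable_fun setT (fun z : R * (W * W) => z.2.2).
Proof. exact: measurableT_comp measurable_snd measurable_snd. Qed.

Let mF : measurable_fun setT F.
Proof.
apply: emeasurable_funM.
  by apply/measurable_EFinP; apply: measurable_normV; exact: measurable_perpetuity.
apply: (measurableT_comp mpsi); apply: measurable_fun_pair => //.
by apply: measurable_flow => //; apply: mnorm; exact: measurable_perpetuity.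
Qed.

Let F0 z : (0 <= F z)%E.
Proof. by rewrite mule_ge0// lee_fin invr_ge0. Qed.

Let mG1 d' (T : measurableType d') (cu cj : T -> R) (cw : T -> W) :
  measurable_fun setT cu -> measurable_fun setT cj -> measurable_fun setT cw ->
  measurable_fun setT (fun t => G1 (cu t) (cj t) (cw t)).
Proof.
move=> mu mj mw.
have mc : measurable_fun setT (fun t => clock al (y (cw t)) (cu t)).
  exact: (measurable_clock_path my mw al mu).
have ma : measurable_fun setT (fun t => y (cw t) (cu t)).
  exact: (measurable_path_at my mu mw).
have mj' := measurable_normV mj.
have mjc : measurable_fun setT (fun t => cj t + clock al (y (cw t)) (cu t)).
  exact: measurable_funD.
apply: emeasurable_funM; last first.
  apply/measurable_EFinP; apply: measurable_funM; last exact: measurable_normV.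
  by apply: measurableT_comp => //; apply: measurable_funM.
apply: (measurableT_comp mpsi); apply: measurable_fun_pair.
  apply: measurableT_comp; first exact: measurable_ln.
  by apply: measurable_funD => //; apply: measurable_funM.
by apply: measurable_funM; [exact: mnorm|exact: measurableT_comp].
Qed.

Let G10 u j w : (0 <= G1 u j w)%E.
Proof. by rewrite mule_ge0// lee_fin mulr_ge0 ?expR_ge0 ?invr_ge0. Qed.

Let mG : measurable_fun setT G.
Proof.
have mj : measurable_fun setT (fun z : R * (W * W) => perpetuity z.2.1).
  exact: measurable_perpetuity.
apply: emeasurable_funM; last exact: mG1.
by apply/measurable_EFinP; exact: measurable_normV.
Qed.

Let G0 z : (0 <= G z)%E.
Proof. by rewrite mule_ge0 ?lee_fin ?invr_ge0. Qed.

Let mH : measurable_fun setT H.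
Proof.
have mz : measurable_fun setT (fun z : \bar R * (R * R) => fine z.1).
  exact: (measurableT_comp (f := fine)).
have ma : measurable_fun setT (fun z : \bar R * (R * R) => z.2.1).
  exact: measurableT_comp measurable_fst measurable_snd.
have mb : measurable_fun setT (fun z : \bar R * (R * R) => z.2.2).
  exact: measurableT_comp measurable_snd measurable_snd.
have mzb : measurable_fun setT (fun z : \bar R * (R * R) => `|fine z.1 - z.2.2|^-1).
  by apply: measurable_normV; exact: measurable_funB.
apply: emeasurable_funM.
  apply/measurable_EFinP; apply: measurable_funM.
    by apply: measurable_funM => //; exact: measurable_normV.
  by apply: measurableT_comp => //; apply: measurable_funM.
apply: (measurableT_comp mpsi); apply: measurable_fun_pair; last exact: mnorm.
apply: measurableT_comp; first exact: measurable_ln.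
by apply: measurable_funD => //; apply: measurable_funM.
Qed.

Let H0 z : (0 <= H z)%E.
Proof.
by rewrite mule_ge0// lee_fin !mulr_ge0 ?expR_ge0 ?invr_ge0.
Qed.

(** With J' for the lifespan of p.1, put J = e^(-al y_u) (A_u + J') and B = e^(-al y_u) A_u. Then J
    - B = e^(-al y_u) J', hence B / (J - B) = A_u / J' and J^(-1/al) = (A_u + J')^(-1/al) e^(y_u).
    The three factors of the weight in H combine to e^(al y_u) / (J' (A_u + J')), the weight in
    G. *)
Let GH u p : 0 < u ->
  G (u, p) = H ((expR (- al * y p.2 u))%:E * ((clock al (y p.2) u)%:E + lifespan al (y p.1)),
        (y p.2 u, expR (- al * y p.2 u) * clock al (y p.2) u)%R)%E.
Proof.
move=> u0; rewrite /G /H /G1 /=.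
case: perpetuityP => [|j j0] /=.
  (* If J' is infinite, [fine] yields 0 on both sides and 0^-1 = 0 kills both integrands. *)
  rewrite addey// gt0_muley ?lte_fin ?expR_gt0//=.
  by rewrite normr0 invr0 !mul0r !mul0e.
set a := y p.2 u; set A := clock al (y p.2) u.
have A0 : 0 <= A by exact: clock_ge0.
have jA0 : 0 < j + A by rewrite ltr_wpDr.
have e0 : 0 < expR (- al * a) by exact: expR_gt0.
have -> : expR (- al * a) * (A + j) - expR (- al * a) * A = expR (- al * a) * j by ring.
rewrite !gtr0_norm ?mulr_gt0 1?[A + j]addrC//.
have -> : expR (- al * a) * A * (expR (- al * a) * j)^-1 = A / j.
  by rewrite invfM mulrACA mulfV ?gt_eqF// mul1r.
have -> : (expR (- al * a) * (j + A)) `^ (- al^-1) = (j + A) `^ (- al^-1) * expR a.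
  rewrite powRM ?(ltW e0) ?(ltW jA0)// mulrC; congr (_ * _).
  rewrite -expRM mulNr mulrN mulNr opprK.
  by rewrite mulrAC mulfV ?gt_eqF// mul1r.
have -> : expR (al * a) = (expR (- al * a))^-1 by rewrite -expRN mulNr opprK.
rewrite muleCA [RHS]muleC -EFinM; congr (_ * _%:E)%E.
by field; rewrite !gt_eqF.
Qed.

Lemma integral_flow_clock (w1 w2 : W) : y w2 t @[t --> +oo] --> +oo ->
  (\int[mu]_(v in `[0%R, +oo[) F (v, (w1, w2)) =
   \int[mu]_(u in `[0%R, +oo[) G (u, (w1, w2)))%E.
Proof.
move=> y2oo; rewrite /F /G /=; case: perpetuityP => [|j j0].
  by rewrite normr0 invr0 !integral0_eq// => x _; rewrite mul0e.
have mf : measurable_fun setT (fun v => psi (v, flow al v (j `^ (- al^-1)) (y w2))).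
  apply: (measurableT_comp mpsi); apply: measurable_fun_pair => //.
  by apply: (@measurable_flow _ _ _ y my ry _ _ (cst (j `^ (- al^-1))) (cst w2) _ _ al id).
have mg : measurable_fun setT (fun u => G1 u j w2).
  by apply: (@mG1 _ _ id (cst j) (cst w2)).
rewrite ge0_integralZl//; last exact: measurable_funTS.
rewrite ge0_integralZl//; last exact: measurable_funTS.
congr (_ * _)%E; rewrite (flow_subst al0 j0 mpsi psi0 (ry w2) y2oo).
apply: eq_integral => u; rewrite inE/= in_itv/= andbT => u0.
rewrite /G1 !gtr0_norm// ltr_wpDr//; exact: clock_ge0.
Qed.

Let product_integralE (f : W * W -> \bar R) : measurable_fun setT f ->
  (forall p, 0 <= f p)%E ->
  (\int[Q \x Q]_p f p = \int[Q]_w1 \int[Q]_w2 f (w1, w2))%E.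
Proof. by move=> mf f0; exact: fubini_tonelli1. Qed.

(** Only the path driving the flow has to tend to +oo. In the iterated integral the exceptional
    paths form a null set of the second coordinate for each fixed first one. *)
Lemma integral_product_ae (f g : W * W -> \bar R) :
  measurable_fun setT f -> measurable_fun setT g ->
  (forall p, 0 <= f p)%E -> (forall p, 0 <= g p)%E ->
  (forall w1 w2, y w2 t @[t --> +oo] --> +oo -> f (w1, w2) = g (w1, w2)) ->
  (\int[Q \x Q]_p f p = \int[Q \x Q]_p g p)%E.
Proof.
move=> mf mg f0 g0 fg; rewrite (product_integralE mf f0) (product_integralE mg g0).
apply: eq_integral => w1 _.
apply: ge0_ae_eq_integral => //.
- exact: measurable_fun_pair2.
- exact: measurable_fun_pair2.
- by apply: filterS yoo => w2 yw2 _; exact: fg.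
Qed.

Lemma integral_age (w : W) :
  (\int[mu]_(u in `[0%R, +oo[)
     H (lifespan al (y w), (y w u, clock (- al) (y w) u)) =
   \int[mu]_(v in `[0%R, +oo[)
     ((`|perpetuity w|^-1)%R%:E * psi (v, perpetuity w `^ (- al^-1))%R))%E.
Proof.
rewrite /H/= -/(perpetuity w); have := perpetuityP w.
move E : (lifespan al (y w)) => L; move E' : (perpetuity w) => J S.
case: J L / S E E' => [|j j0] E E'.
  by rewrite normr0 invr0 !integral0_eq// => x _; rewrite ?mul0r mul0e.
have mf : measurable_fun setT (fun v => psi (v, j `^ (- al^-1))).
  by apply: (measurableT_comp mpsi); apply: measurable_fun_pair.
rewrite ge0_integralZl//; last exact: measurable_funTS.
have [Bj ->] := age_subst j0 (ry w) mf (fun v => psi0 _) E.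
pose B u := clock (- al) (y w) u.
pose K u := (psi (ln (1 + B u * `|j - B u|^-1), j `^ (- al^-1))%R *
  (expR (- al * y w u) * `|j - B u|^-1)%R%:E)%E.
have mB : measurable_fun setT B by exact: measurable_clock.
have mjB : measurable_fun setT (fun u => `|j - B u|^-1).
  by apply: measurable_normV; exact: measurable_funB.
have mK : measurable_fun setT K.
  apply: emeasurable_funM.
    apply: (measurableT_comp mpsi); apply: measurable_fun_pair => //.
    apply: measurableT_comp; first exact: measurable_ln.
    by apply: measurable_funD => //; apply: measurable_funM.
  apply/measurable_EFinP; apply: measurable_funM => //.
  exact: measurable_expR_path.
have K0 u : (0 <= K u)%E.
  by rewrite mule_ge0// lee_fin mulr_ge0 ?expR_ge0 ?invr_ge0.
transitivity ((`|j|^-1)%:E * \int[mu]_(u in `[0%R, +oo[) K u)%E; last first.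
  congr (_ * _)%E; apply: eq_integral => u; rewrite inE/= in_itv/= andbT => u0.
  by rewrite /K gtr0_norm// subr_gt0; exact: Bj.
rewrite -ge0_integralZl//; last exact: measurable_funTS.
by apply: eq_integral => u _; rewrite /K muleC [in RHS]muleCA -EFinM; congr (_ * _%:E)%E; ring.
Qed.

Let QQ0 : subprobability (W * W)%type R :=
  product_subprobability (Q : subprobability W R, Q : subprobability W R).

Let QQ : {sigma_finite_measure set (W * W)%type -> \bar R} := QQ0.

Lemma stationary_integral :
  (\int[mu]_(v in `[0%R, +oo[) \int[Q]_w1 ((`|perpetuity w1|^-1)%R%:E *
      \int[Q]_w2 psi (v, flow al v (perpetuity w1 `^ (- al^-1)) (y w2))%R) =
   \int[mu]_(v in `[0%R, +oo[) \int[Q]_w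
     ((`|perpetuity w|^-1)%R%:E * psi (v, perpetuity w `^ (- al^-1))%R))%E.
Proof.
pose E (z : R * W) := ((`|perpetuity z.2|^-1)%R%:E * psi (z.1, perpetuity z.2 `^ (- al^-1))%R)%E.
have mE : measurable_fun setT E.
  have mj : measurable_fun setT (fun z : R * W => perpetuity z.2) by exact: measurable_perpetuity.
  apply: emeasurable_funM; first by apply/measurable_EFinP; exact: measurable_normV.
  by apply: (measurableT_comp mpsi); apply: measurable_fun_pair => //; exact: mnorm.
have E0 z : (0 <= E z)%E by rewrite mule_ge0// lee_fin invr_ge0.
pose HH (z : R * W) := H (lifespan al (y z.2), (y z.2 z.1, clock (- al) (y z.2) z.1)).
have mHH : measurable_fun setT HH.
  apply: (measurableT_comp mH); apply: measurable_fun_pair.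
    exact: (measurable_lifespan my measurable_snd).
  apply: measurable_fun_pair; first exact: (measurable_path_at my).
  exact: (measurable_clock_path my).
transitivity (\int[mu]_(v in `[0%R, +oo[) \int[Q \x Q]_p F (v, p))%E.
  apply: eq_integral => v _.
  rewrite (product_integralE (f := fun p => F (v, p)) (measurable_fun_pair2 v mF) (fun p => F0 _)).
  apply: eq_integral => w1 _; rewrite /F /= ge0_integralZl//.
  apply: (measurableT_comp mpsi); apply: measurable_fun_pair => //.
  exact: (@measurable_flow _ _ _ y my ry _ _ (cst (perpetuity w1 `^ (- al^-1))) id _ _ al (cst v)).
transitivity (\int[Q \x Q]_p \int[mu]_(v in `[0%R, +oo[) F (v, p))%E.
  exact (@halfline_fubini R _ _ QQ F mF F0).
transitivity (\int[Q \x Q]_p \int[mu]_(u in `[0%R, +oo[) G (u, p))%E.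
  apply: integral_product_ae.
  - exact: (measurable_halfline_integral mF F0).
  - exact: (measurable_halfline_integral mG G0).
  - by move=> p; apply: integral_ge0 => v _; exact: F0.
  - by move=> p; apply: integral_ge0 => v _; exact: G0.
  - by move=> w1 w2; exact: integral_flow_clock.
transitivity (\int[mu]_(u in `[0%R, +oo[) \int[Q \x Q]_p G (u, p))%E.
  by apply/esym; exact (@halfline_fubini R _ _ QQ G mG G0).
transitivity (\int[mu]_(u in `[0%R, +oo[) \int[Q]_w HH (u, w))%E.
  (* Reversal is available for u > 0 only; the point u = 0 is negligible and is dropped on both
     sides. *)
  rewrite -[LHS]integral_itv_obnd_cbnd; last first.
    apply: measurable_funTS; exact (@measurable_fun_fubini_tonelli_F _ _ _ _ R QQ G mG G0).
  rewrite -[RHS]integral_itv_obnd_cbnd; last first.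
    apply: measurable_funTS.
    exact (@measurable_fun_fubini_tonelli_F _ _ _ _ R Q HH mHH (fun z => H0 _)).
  apply: eq_integral => u; rewrite inE/= in_itv/= andbT => u0.
  rewrite -[RHS](integral_transfer hY al u0 mH H0).
  by apply: eq_integral => p _; exact: GH.
transitivity (\int[Q]_w \int[mu]_(u in `[0%R, +oo[) HH (u, w))%E.
  exact (@halfline_fubini R _ _ Q HH mHH (fun z => H0 _)).
transitivity (\int[Q]_w \int[mu]_(v in `[0%R, +oo[) E (v, w))%E.
  by apply: eq_integral => w _; exact: integral_age.
by apply/esym; exact (@halfline_fubini R _ _ Q E mE E0).
Qed.

End stationarity.

(** * The pssMp and the Levy path *)

Section killed_paths.
Context (R : realType) d (W : measurableType d) (Q : probability W R).
Local Notation mu := (@lebesgue_measure R).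
Variables (al : R) (al0 : 0 < al).
Variables (Y : R -> W -> R) (zeta : W -> \bar R) (xi : R -> W -> \bar R).
Hypotheses (hY : levy Q Y) (mzeta : measurable_fun setT zeta).
Hypothesis zeta0 : forall w, (0 <= zeta w)%E.
Hypothesis xiE : forall t w, 0 <= t ->
  xi t w = if (t%:E < zeta w)%E then (Y t w)%:E else -oo%E.
Hypothesis hdrift : drifts_to_infinity Q xi.
Local Notation y := (lpath Y).

Lemma lifetimeE w : lifetime (xi ^~ w) = zeta w.
Proof.
apply/eqP; rewrite eq_le; apply/andP; split; last first.
  apply: le_ereal_inf_tmp => _ [t [t0 + <-]].
  by rewrite /= xiE//; case: ltP.
have : (0 <= zeta w)%E by exact: zeta0.
case E : (zeta w) => [z||]// z0; last by rewrite leey.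
apply: ereal_inf_lbound; exists z => //; split; first by rewrite -lee_fin.
by rewrite /= xiE ?E ?ltxx// -lee_fin.
Qed.

(** Adding [Y 0] back makes this the killed exponential on every path, so that measurability of the
    Lamperti path and of the exponential functional holds before any null set is discarded. *)
Definition killed_exp (a : R) (z : R * W) : R :=
  if (z.1%:E < zeta z.2)%E then expR (a * (y z.2 z.1 + Y 0 z.2)) else 0.

Lemma killed_expE a u w : 0 <= u -> (u%:E < zeta w)%E -> killed_exp a (u, w) = expR (a * Y u w).
Proof.
by move=> u0 uz; rewrite /killed_exp/= uz /lpath max_r// subrK.
Qed.

Lemma killed_exp_ge0 a z : 0 <= killed_exp a z.
Proof. by rewrite /killed_exp; case: ifP => // _; exact: expR_ge0. Qed.

Lemma measurable_killed_exp a : measurable_fun setT (killed_exp a).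
Proof.
apply: measurable_fun_ifT => //.
  apply: measurable_fun_lte; first exact/measurable_EFinP.
  exact: measurableT_comp mzeta measurable_snd.
apply: measurableT_comp => //; apply: measurable_funM => //.
apply: measurable_funD; first exact: measurable_lpath2 hY.
exact: measurableT_comp (levy_measurable hY (lexx 0)) measurable_snd.
Qed.

Lemma expeR_xi u w : 0 <= u -> expeR (al%:E * xi u w) = (killed_exp al (u, w))%:E.
Proof.
move=> u0; rewrite xiE//; case: ifPn => uz; first by rewrite killed_expE.
by rewrite /killed_exp/= (negbTE uz) gt0_muleNy// lte_fin.
Qed.

Lemma integral_xi q w :
  (\int[mu]_(u in `[0%R, q]) expeR (al%:E * xi u w) =
   \int[mu]_(u in `[0%R, +oo[) ((killed_exp al (u, w))%:E * (\1_`]-oo, q] u)%:E))%E.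
Proof.
rewrite integral_mkcond [RHS]integral_mkcond; apply: eq_integral => u _.
rewrite !patchE !mem_setE !in_itv/= andbT indicE mem_setE in_itv/=.
case: ifPn => [/andP[u0 uq]|]; first by rewrite u0 uq mule1 expeR_xi.
by rewrite negb_and; case: (0 <= u) => //= /negbTE ->; rewrite mule0.
Qed.

Lemma measurable_integral_xi q :
  measurable_fun setT (fun w => \int[mu]_(u in `[0%R, q]) expeR (al%:E * xi u w))%E.
Proof.
under eq_fun do rewrite integral_xi.
pose f (z : R * W) := ((killed_exp al z)%:E * (\1_`]-oo, q] z.1)%:E)%E.
apply: (@measurable_halfline_integral _ _ _ f).
  apply: emeasurable_funM; apply/measurable_EFinP; first exact: measurable_killed_exp.
  apply: (measurableT_comp (f := \1_`]-oo, q] : R -> R)) => //.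
by move=> z; rewrite mule_ge0// lee_fin ?killed_exp_ge0.
Qed.

Lemma measurable_expeR_xi w :
  measurable_fun (`[0, +oo[ : set R) (fun u => expeR (al%:E * xi u w)).
Proof.
apply: (eq_measurable_fun (fun u => (killed_exp al (u, w))%:E)).
  by move=> u; rewrite inE/= in_itv/= andbT => u0; rewrite expeR_xi.
apply/measurable_EFinP; apply: measurable_funTS.
exact: (measurable_fun_pair1 w (measurable_killed_exp al)).
Qed.

Lemma measurable_lamperti x t : measurable_fun setT (fun w => lamperti al x (xi ^~ w) t).
Proof.
pose tau w := time_change al (xi ^~ w) (t * x `^ (- al)).
have mtau : measurable_fun setT tau.
  apply: (@measurable_time_change _ _ _ al (cst (t * x `^ (- al))) (fun w => xi ^~ w)) => //.
  - exact: measurable_expeR_xi.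
  - exact: measurable_integral_xi.
rewrite (_ : (fun w => _) = (fun w =>
    if (tau w < zeta w)%E then x * expR (y w (fine (tau w)) + Y 0 w) else 0)).
  apply: measurable_fun_ifT => //; first exact: measurable_fun_lte.
  apply: measurable_funM => //; apply: measurableT_comp => //.
  apply: measurable_funD; last exact: levy_measurable hY _ (lexx 0).
  by apply: (measurable_path_at (measurable_lpath2 hY)) => //; exact: measurableT_comp.
apply/funext => w; rewrite /lamperti lifetimeE -/(tau w); case: ifPn => // tz.
have tau0 : (0 <= tau w)%E.
  by apply: le_ereal_inf_tmp => _ [s [s0 _] <-]; rewrite lee_fin ltW.
have tfin : tau w \is a fin_num.
  by rewrite ge0_fin_numE//; apply: (lt_le_trans tz); exact: leey.
have ftau0 : 0 <= fine (tau w) by rewrite fine_ge0.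
by rewrite xiE// fineK// tz/= /lpath max_r// subrK.
Qed.

Lemma exp_functional_dual w : exp_functional al (dual_path (xi ^~ w)) =
  (\int[mu]_(u in `[0%R, +oo[) (killed_exp (- al) (u, w))%:E)%E.
Proof.
rewrite /exp_functional.
have -> : lifetime (dual_path (xi ^~ w)) = zeta w.
  rewrite -lifetimeE /lifetime; congr ereal_inf; apply/seteqP; split => z [s [s0 sE] <-];
    exists s => //; split => //; move: sE; rewrite /dual_path/=.
    by case: eqP => // _; rewrite xiE//; case: ifP.
  by move=> ->; rewrite eqxx.
rewrite integral_mkcond [RHS]integral_mkcond; apply: eq_integral => u _.
rewrite !patchE mem_setE in_itv/= andbT; case: ifPn.
  rewrite inE/= => -[u0 uz]; rewrite u0 /dual_path xiE// uz/= killed_expE//.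
  by rewrite mulrN mulNr.
rewrite notin_setE/= => /not_andP[/negP/negbTE ->//|/negP uz].
by case: ifP => // _; rewrite /killed_exp/= (negbTE uz).
Qed.

Lemma measurable_exp_functional_dual :
  measurable_fun setT (fun w => exp_functional al (dual_path (xi ^~ w))).
Proof.
under eq_fun do rewrite exp_functional_dual.
apply: (@measurable_halfline_integral _ _ _ (fun z => (killed_exp (- al) z)%:E)).
  by apply/measurable_EFinP; exact: measurable_killed_exp.
by move=> z; rewrite lee_fin killed_exp_ge0.
Qed.

Definition typical (w : W) : Prop :=
  [/\ zeta w = +oo%E, Y 0 w = 0 & y w t @[t --> +oo] --> +oo].

(** After a finite killing time the path stays at -oo and cannot tend to +oo, so drift forces [zeta]
    to be infinite. *)
Lemma typical_ae : {ae Q, forall w, typical w}.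
Proof.
apply: filterS2 (levy_start hY) hdrift => w Y0 xioo.
have zoo : zeta w = +oo%E.
  have : (0 <= zeta w)%E by exact: zeta0.
  case E : (zeta w) => [z||]// z0; exfalso.
  have /cvgeyPgt/(_ 0)[M [Mr HM]] := xioo.
  (* A time past both the killing time z and the threshold M, and nonnegative so that [xiE]
     applies. *)
  pose t0 := Num.max z (Num.max 0 (M + 1)).
  have t00 : 0 <= t0 by rewrite /t0 !le_max lexx/= orbT.
  have zt0 : z <= t0 by rewrite /t0 le_max lexx.
  have Mt0 : M < t0 by rewrite /t0 !lt_max ltrDl ltr01 !orbT.
  have tz : (t0%:E < z%:E)%E = false by apply/negbTE; rewrite -leNgt lee_fin.
  by have := HM t0 Mt0; rewrite xiE// E tz.
split => //.
have Yoo : Y t w @[t --> +oo] --> +oo.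
  apply/cvgeryP; apply: cvg_trans xioo; apply: near_eq_cvg.
  near=> t; rewrite xiE ?zoo ?ltry//.
apply: cvg_trans Yoo; apply: near_eq_cvg; near=> t.
by rewrite /lpath max_r// Y0 subr0.
Unshelve. all: by end_near. Qed.

Lemma lamperti_typical x t w : typical w ->
  lamperti al x (xi ^~ w) t = pssmp_path al t x (y w).
Proof.
move=> [zoo Y0 yoo].
have yE u : 0 <= u -> xi u w = (y w u)%:E.
  by move=> u0; rewrite xiE// zoo ltry /lpath max_r// Y0 subr0.
have tcE c : time_change al (xi ^~ w) c = time_change al (EFin \o y w) c.
  congr ereal_inf; apply/seteqP; split => z [s [s0 cs] <-]; exists s => //; split => //;
    move: cs; congr (_ < _)%E; apply: eq_integral => u; rewrite inE/= in_itv/=;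
    by move=> /andP[u0 _]; rewrite yE.
rewrite /lamperti lifetimeE zoo tcE.
have tc_fin := time_change_fin al0 (rcll_lpath hY w) yoo (t * x `^ (- al)).
rewrite tc_fin yE//=; apply: fine_ge0; apply: le_ereal_inf_tmp => _ [s [s0 _] <-].
by rewrite lee_fin ltW.
Qed.

Lemma exp_functional_typical w : typical w ->
  exp_functional al (dual_path (xi ^~ w)) = lifespan al (y w).
Proof.
move=> [zoo Y0 yoo]; rewrite exp_functional_dual; apply: eq_integral => u _.
by rewrite /killed_exp/= zoo ltry Y0 addr0.
Qed.

End killed_paths.

Lemma path_events_at (R : realType) (t : R) (B : set R) :
  0 <= t -> measurable B -> path_events [set v : R -> R | B (v t)].
Proof. by move=> t0 mB; apply: sub_gen_smallest; exists t, B. Qed.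

Lemma measure_preimage (R : realType) d (T : measurableType d)
    (m : {measure set T -> \bar R}) (g : T -> R) (B : set R) :
  measurable (g @^-1` B) -> m (g @^-1` B) = (\int[m]_w (\1_B (g w))%:E)%E.
Proof.
move=> mgB; transitivity (\int[m]_w (\1_(g @^-1` B) w)%:E)%E; last by [].
by rewrite integral_indic// setIT.
Qed.

(** * Expectations of X as expectations over the Levy path *)

Section pssmp_law.
Context (R : realType) d' (W : measurableType d') (Q : probability W R).
Local Notation mu := (@lebesgue_measure R).
Variables (al : R) (al0 : 0 < al).
Variables (Y : R -> W -> R) (zeta : W -> \bar R) (xi : R -> W -> \bar R).
Hypotheses (hY : levy Q Y) (mzeta : measurable_fun setT zeta).
Hypothesis zeta0 : forall w, (0 <= zeta w)%E.
Hypothesis xiE : forall t w, 0 <= t ->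
  xi t w = if (t%:E < zeta w)%E then (Y t w)%:E else -oo%E.
Hypothesis hdrift : drifts_to_infinity Q xi.
Local Notation y := (lpath Y).
Context d (T : measurableType d) (F : R -> set (set T)) (X : R -> T -> R)
  (P : R -> probability T R).
Hypotheses (hX : pssMp al F X P) (hassoc : lamperti_associated al X P Q xi).

Let my : measurable_fun setT (fun p : R * W => y p.2 p.1).
Proof. exact: measurable_lpath2 hY. Qed.

Let ry : forall w, rcll (y w).
Proof. exact: rcll_lpath hY. Qed.

Lemma measurable_X t : 0 <= t -> measurable_fun setT (X t).
Proof.
move=> t0 _ B mB; rewrite setTI.
have [_ Fm _] := pssMp_filtration hX.
by apply: (Fm t t0); exact: pssMp_adapted hX t B t0 mB.
Qed.

(** Equality of path laws is taken at one coordinate, and almost every Levy path is typical, where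
    Lamperti's formula reduces to [pssmp_path]. *)
Lemma integral_pssmp t x (f : R -> \bar R) : 0 <= t -> 0 < x ->
  measurable_fun setT f -> (forall z, 0 <= f z)%E ->
  (\int[P x]_w f (X t w) = \int[Q]_w f (pssmp_path al t x (y w)))%E.
Proof.
move=> t0 x0 mf f0.
have mX := measurable_X t0.
have mL : measurable_fun setT (fun w => lamperti al x (xi ^~ w) t).
  exact: (measurable_lamperti al0 hY mzeta zeta0 xiE).
have E1 := @ge0_integral_pushforward _ _ _ _ _ _ mX (P x) setT f measurableT mf (fun y _ => f0 y).
have E2 := @ge0_integral_pushforward _ _ _ _ _ _ mL Q setT f measurableT mf (fun y _ => f0 y).
rewrite !preimage_setT in E1 E2.
transitivity (\int[Q]_w f (lamperti al x (xi ^~ w) t))%E.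
  rewrite -[LHS]E1 -[RHS]E2.
  apply: eq_measure_integral => A mA _.
  exact: (hassoc x0 (path_events_at t0 mA)).
apply: ge0_ae_eq_integral => //.
- exact: (measurableT_comp mf).
- apply: (measurableT_comp mf).
  exact: (@measurable_pssmp_path _ _ _ y my ry _ _ (cst x) id _ _ al (cst t)).
- apply: filterS (typical_ae hY zeta0 xiE hdrift) => w gw _ /=.
  by rewrite (lamperti_typical al0 hY zeta0 xiE).
Qed.

Lemma measurable_pssmp_integral t (f : R -> \bar R) :
  measurable_fun setT f -> (forall z, 0 <= f z)%E ->
  measurable_fun setT (fun x => \int[Q]_w f (pssmp_path al t x (y w)))%E.
Proof.
move=> mf f0.
pose g (z : R * W) := f (pssmp_path al t z.1 (y z.2)).
have mg : measurable_fun setT g.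
  apply: (measurableT_comp mf).
  exact: (@measurable_pssmp_path _ _ _ y my ry _ _ fst snd _ _ al (cst t)).
exact (@measurable_fun_fubini_tonelli_F _ _ _ _ R Q g mg (fun z => f0 _)).
Qed.

(** The Markov property of X at time s restarts from X s under a fresh law; expressing both laws
    through the Levy path makes the restart an independent path w2. Sets come first because
    [pssMp_markov] speaks of probabilities of events. *)
Lemma pssmp_markov_set s t x (B : set R) : 0 <= s -> 0 <= t -> 0 < x -> measurable B ->
  (\int[Q]_w (\1_B (pssmp_path al (s + t) x (y w)))%:E =
   \int[Q]_w1 \int[Q]_w2
     (\1_B (pssmp_path al t (pssmp_path al s x (y w1)) (y w2)))%:E)%E.
Proof.
move=> s0 t0 x0 mB.
pose f (z : R) : \bar R := (\1_B z)%:E.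
have mf : measurable_fun setT f.
  by apply/measurable_EFinP; exact: measurable_indic.
have f0 z : (0 <= f z)%E by rewrite lee_fin.
have PE z : 0 < z -> P z [set w | B (X t w)] =
    (\int[Q]_w f (pssmp_path al t z (y w)))%E.
  move=> z0; rewrite -integral_pssmp//.
  have mXB : measurable (X t @^-1` B).
    by rewrite -[X in measurable X]setTI; exact: measurable_X.
  transitivity (\int[P z]_w (\1_(X t @^-1` B) w)%:E)%E; last by [].
  by rewrite integral_indic ?setIT.
have st0 : 0 <= s + t by exact: addr_ge0.
pose h (z : R) := P z [set w | B (X t w)].
transitivity (\int[P x]_w f (X (s + t) w))%E.
  by rewrite (integral_pssmp st0 x0 mf f0).
transitivity (P x [set w | B (X (s + t) w)]).
  have mXB : measurable (X (s + t) @^-1` B).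
    by rewrite -[X in measurable X]setTI; exact: measurable_X.
  transitivity (\int[P x]_w (\1_(X (s + t) @^-1` B) w)%:E)%E; first by [].
  by rewrite integral_indic ?setIT.
have [sF Fm Fmono] := pssMp_filtration hX.
have := pssMp_markov hX (tau := cst s%:E) (A := setT) (ltW x0).
move=> /(_ [set v | B (v t)]) M.
have -> : P x [set w | B (X (s + t) w)] = (\int[P x]_w h (X s w))%E.
  have FT r : 0 <= r -> F r setT.
    by move=> r0; have [F0 FC _] := sF r r0; rewrite -(setD0 setT); exact: FC.
  have Fs r : 0 <= r -> F r [set w | (cst s%:E w <= r%:E)%E].
    move=> r0; have [F0 _ _] := sF r r0.
    have [sr|rs] := boolP (s%:E <= r%:E)%E.
      rewrite (_ : [set w | _] = setT); first exact: FT.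
      by apply/seteqP; split.
    rewrite (_ : [set w | _] = set0)//.
    by apply/seteqP; split => // w /=; rewrite (negbTE rs).
  have stop : stopping_time F (cst s%:E).
    by split => // w /=; rewrite lee_fin.
  have stopT : stopped_events F (cst s%:E) setT.
    by split => // r r0; rewrite setTI; exact: Fs.
  have := M stop stopT (path_events_at t0 mB); rewrite /= !setTI.
  have -> : [set _ : T | (s%:E < +oo)%E] = setT.
    by apply/seteqP; split => // w _ /=; rewrite ltry.
  by rewrite setTI => E; exact: E.
have mXs := measurable_X s0.
have mk : measurable_fun (`[0, +oo[ : set R) h.
  exact: pssMp_kernel hX _ (path_events_at t0 mB).
have mhX : measurable_fun setT (fun w => h (X s w)).
  apply: (measurable_comp _ _ mk mXs) => //.
  by move=> _ [w _ <-] /=; rewrite in_itv/= andbT; exact: pssMp_ge0 hX _ _ s0.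
pose k z := (\int[Q]_w f (pssmp_path al t z (y w)))%E.
have mkk : measurable_fun setT k by exact: measurable_pssmp_integral.
have k0 z : (0 <= k z)%E by exact: integral_ge0.
transitivity (\int[P x]_w k (X s w))%E; last first.
  by rewrite (integral_pssmp s0 x0 mkk k0).
have mkX : measurable_fun setT (fun w => k (X s w)) by exact: measurableT_comp.
apply: (@ge0_ae_eq_integral _ _ _ (P x) setT _ _ measurableT mhX mkX).
- by move=> w _; exact: measure_ge0.
- by move=> w _; exact: k0.
(* The two kernels are known to agree at positive points only. That X s is almost surely positive
   follows from [integral_pssmp], as [pssmp_path] never vanishes from x > 0. *)
- have mpos : measurable (X s @^-1` `]-oo, 0%R]).
    by rewrite -[X in measurable X]setTI; exact: mXs.
  exists (X s @^-1` `]-oo, 0%R]); split => //.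
    transitivity (\int[P x]_w (\1_`]-oo, 0%R] (X s w))%:E)%E.
      exact: measure_preimage.
    rewrite (integral_pssmp s0 x0 (f := fun z => (\1_`]-oo, 0%R] z)%:E))//.
      rewrite integral0_eq// => w _; rewrite indicE memNset//= in_itv/=.
      by apply/negP; rewrite -ltNge mulr_gt0 ?expR_gt0.
    by apply/measurable_EFinP; apply: measurable_indic; exact: measurable_itv.
  move=> w /=; apply: contra_notP; rewrite in_itv/= => /negP; rewrite -ltNge => X0 _.
  exact: PE.
Qed.

(** The version for sets says that two image measures on the line coincide; integrating f against
    them gives the claim. *)
Lemma pssmp_markov s t x (f : R -> \bar R) : 0 <= s -> 0 <= t -> 0 < x ->
  measurable_fun setT f -> (forall z, 0 <= f z)%E ->
  (\int[Q]_w f (pssmp_path al (s + t) x (y w)) =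
   \int[Q]_w1 \int[Q]_w2 f (pssmp_path al t (pssmp_path al s x (y w1)) (y w2)))%E.
Proof.
move=> s0 t0 x0 mf f0.
pose g1 w := pssmp_path al (s + t) x (y w).
pose g2 (p : W * W) := pssmp_path al t (pssmp_path al s x (y p.1)) (y p.2).
have mg1 : measurable_fun setT g1.
  exact: (@measurable_pssmp_path _ _ _ y my ry _ _ (cst x) id _ _ al (cst (s + t))).
have mg2 : measurable_fun setT g2.
  apply: (@measurable_pssmp_path _ _ _ y my ry _ _
    (fun p : W * W => pssmp_path al s x (y p.1)) snd _ _ al (cst t)) => //.
  by apply: (@measurable_pssmp_path _ _ _ y my ry _ _ (cst x) fst _ _ al (cst s)).
have E1 := @ge0_integral_pushforward _ _ _ _ _ _ mg1 Q setT f measurableT mf (fun y _ => f0 y).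
have E2 := @ge0_integral_pushforward _ _ _ _ _ _ mg2 (Q \x Q)%E setT f measurableT mf (fun y _ => f0 y).
rewrite !preimage_setT in E1 E2.
transitivity (\int[Q \x Q]_p f (g2 p))%E; last first.
  apply: fubini_tonelli1 => [|p]; last exact: f0.
  exact: (measurableT_comp mf).
rewrite -[LHS]E1 -[RHS]E2; apply: eq_measure_integral => B mB _.
have mi1 : measurable (g1 @^-1` B) by rewrite -[X in measurable X]setTI; exact: mg1.
have mi2 : measurable (g2 @^-1` B) by rewrite -[X in measurable X]setTI; exact: mg2.
transitivity (\int[Q]_w (\1_B (g1 w))%:E)%E.
  exact: (@measure_preimage _ _ _ Q g1 B mi1).
rewrite pssmp_markov_set//.
transitivity (\int[Q \x Q]_p (\1_B (g2 p))%:E)%E.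
  apply/esym; apply: (@fubini_tonelli1 _ _ _ _ R Q Q (fun p => (\1_B (g2 p))%:E)).
    apply/measurable_EFinP; apply: (measurableT_comp (f := \1_B : R -> R)) => //.
  by move=> p; rewrite lee_fin.
by apply/esym; exact: (@measure_preimage _ _ _ (Q \x Q)%E g2 B mi2).
Qed.

End pssmp_law.

(** * Invariance and the entrance law *)

Section real_integrals.
Context (R : realType).
Local Notation mu := (@lebesgue_measure R).
Local Open Scope ereal_scope.

Lemma integral_reflect (g : R -> \bar R) (v : R) : measurable_fun setT g ->
  (forall u, 0 <= g u) ->
  \int[mu]_(u in `[0%R, v]) g (v - u)%R = \int[mu]_(u in `[0%R, v]) g u.
Proof.
move=> mg g0; pose r (u : measurableTypeR R) : measurableTypeR R := (v - u)%R.
have mr : measurable_fun setT r by exact: measurable_funB.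
pose nu : {measure set (measurableTypeR R) -> \bar R} := pushforward mu r.
have E A : measurable A -> mu A = pushforward mu r A.
  move=> mA; apply: (lebesgue_measure_unique (mu := nu mr)) => //.
  move=> _ [[a b]] _ <-; rewrite /= /pushforward.
  rewrite (_ : r @^-1` _ = `[(v - b)%R, (v - a)%R[%classic); last first.
    apply/seteqP; split => u; rewrite /r/= !in_itv/=; lra.
  by rewrite !lebesgue_measure_itv/= !lte_fin ltrD2l ltrN2; case: ifP => // _;
    rewrite -!EFinD; congr EFin; ring.
have mI : measurable `[0%R, v]%classic by [].
have := @ge0_integral_pushforward _ _ _ _ _ _ mr mu `[0%R, v]%classic g mI
  (measurable_funTS mg) (fun u _ => g0 u).
rewrite (_ : r @^-1` _ = `[0%R, v]%classic); last first.
  by apply/seteqP; split => u; rewrite /r/= !in_itv/=; lra.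
move=> <-; apply: eq_measure_integral => A mA _; exact/esym/E.
Qed.

Lemma integral_truncate (v : R) (L K : R -> \bar R) :
  (forall u, (0 <= u)%R -> (u <= v)%R -> L u = K u) ->
  (forall u, (v < u)%R -> L u = 0) ->
  \int[mu]_(u in `[0%R, +oo[) L u = \int[mu]_(u in `[0%R, v]) K u.
Proof.
move=> LK L0; rewrite integral_mkcond [RHS]integral_mkcond; apply: eq_integral => u _.
rewrite !patchE !mem_setE !in_itv/= andbT; have [u0|u0] := leP 0%R u => //=.
by have [uv|uv] := leP u v; [exact: LK|exact: L0].
Qed.

End real_integrals.

Section invariance.
Context (R : realType) d' (W : measurableType d') (Q : probability W R).
Local Notation mu := (@lebesgue_measure R).
Variables (al : R) (al0 : 0 < al).
Variables (Y : R -> W -> R).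
Hypothesis hY : levy Q Y.
Local Notation y := (lpath Y).
Hypothesis yoo : {ae Q, forall w, y w t @[t --> +oo] --> +oo}.
Hypothesis markov : forall s t x (f : R -> \bar R), 0 <= s -> 0 <= t -> 0 < x ->
  measurable_fun setT f -> (forall z, 0 <= f z)%E ->
  (\int[Q]_w f (pssmp_path al (s + t) x (y w)) =
   \int[Q]_w1 \int[Q]_w2 f (pssmp_path al t (pssmp_path al s x (y w1)) (y w2)))%E.

Let my : measurable_fun setT (fun p : R * W => y p.2 p.1).
Proof. exact: measurable_lpath2 hY. Qed.

Let ry : forall w, rcll (y w).
Proof. exact: rcll_lpath hY. Qed.

(** Self-similarity: extracting the factor e^(-v1/al) from the starting point of the second flow
    multiplies its running time by e^v1. *)
Lemma flow_flow v1 v2 x z1 z2 : 0 < x ->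
  flow al v2 (flow al v1 x z1) z2 = expR (v1 + v2) `^ (- al^-1) *
    pssmp_path al (expR v1 * (expR v2 - 1)) (pssmp_path al (expR v1 - 1) x z1) z2.
Proof.
move=> x0; rewrite {2}/flow; set q := pssmp_path al (expR v1 - 1) x z1.
have q0 : 0 < q by rewrite mulr_gt0 ?expR_gt0.
have e0 : 0 < expR v1 `^ (- al^-1) by rewrite powR_gt0 ?expR_gt0.
have E : (expR v1 `^ (- al^-1) * q) `^ (- al) = expR v1 * q `^ (- al).
  have -> : (expR v1 `^ (- al^-1) * q) `^ (- al) =
      (expR v1 `^ (- al^-1)) `^ (- al) * q `^ (- al) by rewrite powRM ?ltW.
  have -> : (expR v1 `^ (- al^-1)) `^ (- al) = expR v1 `^ (- al^-1 * - al) by rewrite powRrM.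
  have -> : - al^-1 * - al = 1 by rewrite mulrNN mulVf// gt_eqF.
  by rewrite powRr1 ?expR_ge0.
have E2 : expR (v1 + v2) `^ (- al^-1) = expR v1 `^ (- al^-1) * expR v2 `^ (- al^-1).
  by rewrite expRD powRM ?expR_ge0.
rewrite /flow /pssmp_path E E2.
have -> : (expR v2 - 1) * (expR v1 * q `^ (- al)) = expR v1 * (expR v2 - 1) * q `^ (- al).
  by ring.
by move: (expR (z2 _)) (expR v1 `^ (- al^-1)) (expR v2 `^ (- al^-1)) => a b c; ring.
Qed.

Variable f : R -> \bar R.
Hypotheses (mf : measurable_fun setT f) (f0 : forall z, (0 <= f z)%E).

Definition flow_op (v x : R) : \bar R := (\int[Q]_w f (flow al v x (y w)))%E.

Lemma flow_op_ge0 v x : (0 <= flow_op v x)%E.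
Proof. by apply: integral_ge0. Qed.

Lemma measurable_flow_op d (T : measurableType d) (cv cx : T -> R) :
  measurable_fun setT cv -> measurable_fun setT cx ->
  measurable_fun setT (fun t => flow_op (cv t) (cx t)).
Proof.
move=> mv mx; pose g (z : T * W) := f (flow al (cv z.1) (cx z.1) (y z.2)).
have mg : measurable_fun setT g.
  apply: (measurableT_comp mf).
  apply: (@measurable_flow _ _ _ y my ry _ _ (fun z : T * W => cx z.1) snd _ _ al (fun z => cv z.1)) => //.
  - exact: (measurableT_comp mx).
  - exact: (measurableT_comp mv).
exact (@measurable_fun_fubini_tonelli_F _ _ _ _ R Q g mg (fun z => f0 _)).
Qed.

(** The running times e^v1 - 1 and e^v1 (e^v2 - 1) add up to e^(v1 + v2) - 1, so the Markov property
    of [pssmp_path] becomes a semigroup property in logarithmic time. *)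
Lemma flow_semigroup v1 v2 x : 0 <= v1 -> 0 <= v2 -> 0 < x ->
  (flow_op (v1 + v2) x = \int[Q]_w flow_op v2 (flow al v1 x (y w)))%E.
Proof.
move=> v10 v20 x0.
pose g z := f (expR (v1 + v2) `^ (- al^-1) * z).
have mg : measurable_fun setT g.
  by apply: (measurableT_comp mf); exact: mulrl_measurable.
have s0 : 0 <= expR v1 - 1 by rewrite subr_ge0 -expR0 ler_expR.
have t0 : 0 <= expR v1 * (expR v2 - 1).
  by rewrite mulr_ge0 ?expR_ge0// subr_ge0 -expR0 ler_expR.
have := markov s0 t0 x0 mg (fun z => f0 _).
have -> : expR v1 - 1 + expR v1 * (expR v2 - 1) = expR (v1 + v2) - 1.
  by rewrite expRD; ring.
move=> E; transitivity (\int[Q]_w g (pssmp_path al (expR (v1 + v2) - 1) x (y w)))%E.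
  by [].
rewrite {}E; apply: eq_integral => w1 _; apply: eq_integral => w2 _.
by rewrite flow_flow.
Qed.

Let j := perpetuity Y al.

Definition eta (g : R -> \bar R) : \bar R :=
  (\int[Q]_w ((`|j w|^-1)%R%:E * g (j w `^ (- al^-1))%R))%E.

Let mj : measurable_fun setT j.
Proof. exact: (measurable_perpetuity hY al (@measurable_id _ W setT)). Qed.

Let mx : measurable_fun setT (fun w => j w `^ (- al^-1)).
Proof. by apply: (measurableT_comp (f := fun z : R => z `^ (- al^-1))). Qed.

Let mw : measurable_fun setT (fun w => (`|j w|^-1)%:E).
Proof. by apply/measurable_EFinP; exact: measurable_normV. Qed.

Let w0 w : (0 <= (`|j w|^-1)%:E)%E.
Proof. by rewrite lee_fin invr_ge0. Qed.

Let measurable_eta_flow_op : measurable_fun setT (fun v => eta (flow_op v)).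
Proof.
pose g (z : R * W) := ((`|j z.2|^-1)%:E * flow_op z.1 (j z.2 `^ (- al^-1)))%E.
have mg : measurable_fun setT g.
  apply: emeasurable_funM; first exact: (measurableT_comp mw).
  by apply: measurable_flow_op => //; exact: (measurableT_comp mx).
apply: (@measurable_fun_fubini_tonelli_F _ _ _ _ R Q g mg) => z.
by rewrite mule_ge0// flow_op_ge0.
Qed.

Let eta_flow_op_ge0 v : (0 <= eta (flow_op v))%E.
Proof. by apply: integral_ge0 => w _; rewrite mule_ge0// flow_op_ge0. Qed.

Let jE w : j w = 0 \/ 0 < j w.
Proof. by rewrite /j; case: (perpetuityP hY al w) => [|k k0]; [left|right]. Qed.

Let integral_cst_itv (v : R) (c : \bar R) : 0 < v ->
  (\int[mu]_(u in `[0%R, v]) c = c * v%:E)%E.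
Proof.
move=> v0; rewrite integral_cst//; congr (_ * _)%E.
have muE : mu `[0%R, v]%classic = v%:E by rewrite lebesgue_measure_itv/= lte_fin v0 sube0.
exact: muE.
Qed.

Lemma eta_invariant v : 0 < v -> eta (flow_op v) = eta f.
Proof.
move=> v0.
(* Only v, finite and positive, is cancelled; the values of eta may be infinite. *)
suff : (eta (flow_op v) * v%:E = eta f * v%:E)%E.
  have vK c : (c * v%:E * (v^-1)%:E = c)%E.
    by rewrite -muleA -EFinM mulfV ?gt_eqF// mule1.
  by move=> E; rewrite -[LHS]vK E vK.
rewrite -(integral_cst_itv (eta (flow_op v)) v0) -(integral_cst_itv (eta f) v0).
(* The cut-off keeps the remaining time v - u nonnegative, as the semigroup property requires. *)
pose psi1 (z : R * R) := ((\1_`]-oo, v] z.1)%:E * flow_op (v - z.1) z.2)%E.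
pose psi2 (z : R * R) := ((\1_`]-oo, v] z.1)%:E * f z.2)%E.
have mi : measurable_fun setT (fun z : R * R => (\1_`]-oo, v] z.1 : R)%:E).
  apply/measurable_EFinP; apply: (measurableT_comp (f := \1_`]-oo, v] : R -> R)) => //.
have mpsi1 : measurable_fun setT psi1.
  by apply: emeasurable_funM => //; apply: measurable_flow_op => //; exact: measurable_funB.
have mpsi2 : measurable_fun setT psi2.
  by apply: emeasurable_funM => //; exact: (measurableT_comp mf).
have psi10 z : (0 <= psi1 z)%E by rewrite mule_ge0 ?flow_op_ge0// lee_fin.
have psi20 z : (0 <= psi2 z)%E by rewrite mule_ge0// lee_fin.
have in1 u : u <= v -> \1_`]-oo, v] u = 1 :> R.
  by move=> uv; rewrite indicE mem_set//= in_itv.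
have in0 u : v < u -> \1_`]-oo, v] u = 0 :> R.
  by move=> uv; rewrite indicE memNset//= in_itv/= leNgt uv.
have in_psi1 u z : u <= v -> psi1 (u, z) = flow_op (v - u) z.
  by move=> uv; rewrite /psi1/= in1// mul1e.
have out_psi1 u z : v < u -> psi1 (u, z) = 0%E.
  by move=> uv; rewrite /psi1/= in0// mul0e.
have in_psi2 u z : u <= v -> psi2 (u, z) = f z.
  by move=> uv; rewrite /psi2/= in1// mul1e.
have out_psi2 u z : v < u -> psi2 (u, z) = 0%E.
  by move=> uv; rewrite /psi2/= in0// mul0e.
transitivity (\int[mu]_(u in `[0%R, v]) eta (flow_op (v - u)))%E.
  transitivity (\int[mu]_(v1 in `[0%R, +oo[) \int[Q]_w1 ((`|perpetuity Y al w1|^-1)%R%:E *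
      \int[Q]_w2 psi1 (v1, flow al v1 (perpetuity Y al w1 `^ (- al^-1)) (y w2))%R))%E.
    apply/esym; apply: integral_truncate => u.
      move=> u0 uv; apply: eq_integral => w _; rewrite -/j.
      have [->|jw0] := jE w; first by rewrite normr0 invr0 !mul0e.
      congr (_ * _)%E; rewrite -[in RHS](subrKC u v) flow_semigroup ?subr_ge0//; last first.
        by rewrite powR_gt0.
      by apply: eq_integral => w2 _; rewrite in_psi1.
    move=> vu; rewrite integral0_eq// => w _; rewrite integral0_eq ?mule0// => w2 _.
    by rewrite out_psi1.
  rewrite (stationary_integral hY al0 yoo mpsi1 psi10); apply: integral_truncate => u.
    move=> u0 uv; apply: eq_integral => w _.
    by rewrite in_psi1.
  by move=> vu; rewrite integral0_eq// => w _; rewrite out_psi1// mule0.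
(* Reflecting u into v - u links the two uses of stationarity: the right side for [psi1] becomes the
   left side for [psi2]. *)
rewrite (integral_reflect v measurable_eta_flow_op eta_flow_op_ge0).
transitivity (\int[mu]_(v1 in `[0%R, +oo[) \int[Q]_w1 ((`|perpetuity Y al w1|^-1)%R%:E *
    \int[Q]_w2 psi2 (v1, flow al v1 (perpetuity Y al w1 `^ (- al^-1)) (y w2))%R))%E.
  apply/esym; apply: integral_truncate => u.
    move=> u0 uv; apply: eq_integral => w _; congr (_ * _)%E.
    by apply: eq_integral => w2 _; rewrite in_psi2.
  move=> vu; rewrite integral0_eq// => w _; rewrite integral0_eq ?mule0// => w2 _.
  by rewrite out_psi2.
rewrite (stationary_integral hY al0 yoo mpsi2 psi20); apply: integral_truncate => u.
  move=> u0 uv; apply: eq_integral => w _.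
  by rewrite in_psi2.
by move=> vu; rewrite integral0_eq// => w _; rewrite out_psi2// mule0.
Qed.

End invariance.

(** As 0 is absorbing, a path positive at t has not vanished before, and right-continuity keeps it
    positive slightly beyond t; this gives the strict inequality. *)
Lemma lt_T0 (R : realType) (t : R) (v : R -> R) : 0 <= t ->
  cadlag v -> (forall s, 0 <= s -> 0 <= v s) ->
  (forall r s, 0 <= r -> r <= s -> v r = 0 -> v s = 0) ->
  (t%:E < T0 v)%E <-> 0 < v t.
Proof.
move=> t0 [vr _] v0 vcem; split => [tT|vt].
  rewrite lt_neqAle v0// andbT eq_sym; apply/eqP => vt.
  (* [T0] sees strictly positive times only, so a path at 0 at time 0 needs arbitrarily small
     positive times. *)
  have [t00|t00] := eqVneq t 0.
    suff : (T0 v <= 0%:E)%E by rewrite leNgt -t00 tT.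
    apply/lee_addgt0Pr => e e0; rewrite add0e; apply: ereal_inf_lbound.
    by exists e => //; split => //; apply: (vcem t) => //; rewrite t00 ltW.
  suff : (T0 v <= t%:E)%E by rewrite leNgt tT.
  by apply: ereal_inf_lbound; exists t => //; split => //; rewrite lt_def t00.
have /cvgr_gt /(_ _ vt)[e /= e0 He] := vr t t0.
apply: (@lt_le_trans _ _ (t + e)%:E); first by rewrite lte_fin ltrDl.
apply: le_ereal_inf_tmp => _ [s [s0 vs] <-]; rewrite lee_fin leNgt; apply/negP => ste.
have [st|ts] := leP s t.
  by move: vt; rewrite (vcem s t)// ?ltxx// ltW.
have := He s _ ts; rewrite /= vs ltxx => H; suff : false by []; apply: H.
rewrite ltr_distlC; apply/andP; split; [lra|lra].
Qed.

Lemma integral_cst_probability (R : realType) d (T : measurableType d)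
    (P : probability T R) (c : \bar R) : (\int[P]_w c = c)%E.
Proof.
rewrite integral_cst//; have PT : P setT = 1%E := probability_setT P.
by rewrite [X in (_ * X)%E]PT mule1.
Qed.

Lemma restrict_gt0 (R : realType) (h : R -> \bar R) (x : R) :
  (h \_ `]0%R, +oo[) x = if 0 < x then h x else 0%E.
Proof. by rewrite patchE mem_setE in_itv/= andbT. Qed.

(** * Construction and properties of the entrance law *)

Section entrance_law.
Context (R : realType) d' (W : measurableType d') (Q : probability W R).
Variables (al : R) (al0 : 0 < al).
Variables (Y : R -> W -> R) (zeta : W -> \bar R) (xi : R -> W -> \bar R).
Hypotheses (hY : levy Q Y) (mzeta : measurable_fun setT zeta).
Hypothesis zeta0 : forall w, (0 <= zeta w)%E.
Hypothesis xiE : forall t w, 0 <= t ->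
  xi t w = if (t%:E < zeta w)%E then (Y t w)%:E else -oo%E.
Hypothesis hdrift : drifts_to_infinity Q xi.
Local Notation y := (lpath Y).
Context d (T : measurableType d) (F : R -> set (set T)) (X : R -> T -> R)
  (P : R -> probability T R).
Hypotheses (hX : pssMp al F X P) (hassoc : lamperti_associated al X P Q xi).

Let j := perpetuity Y al.

Let mj : measurable_fun setT j.
Proof. exact: (measurable_perpetuity hY al (@measurable_id _ W setT)). Qed.

Let jE w : j w = 0 \/ 0 < j w.
Proof. by rewrite /j; case: (perpetuityP hY al w) => [|k k0]; [left|right]. Qed.

Let rho w := `|j w|^-1.

Let mrho : measurable_fun setT rho.
Proof. exact: measurable_normV. Qed.

Let rho0 w : 0 <= rho w.
Proof. by rewrite invr_ge0. Qed.

(** This is (s/J)^(1/al) as a product: changing s only rescales, which makes the scaling property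
    immediate. *)
Let pt (s : R) (w : W) := s `^ al^-1 * j w `^ (- al^-1).

Let mpt s : measurable_fun setT (pt s).
Proof.
apply: (measurableT_comp (f := fun z : R => s `^ al^-1 * z)).
  exact: mulrl_measurable.
by apply: (measurableT_comp (f := fun z : R => z `^ (- al^-1))).
Qed.

Let pt_gt0 s w : 0 < s -> 0 < j w -> 0 < pt s w.
Proof. by move=> s0 jw0; rewrite mulr_gt0 ?powR_gt0. Qed.

Definition entrance (s : R) : {measure set R -> \bar R} := wpush Q mrho rho0 (mpt s).

Local Notation eta := (eta Q al Y).

Lemma integral_entrance (s : R) (h : R -> \bar R) : 0 < s ->
  measurable_fun (`]0, +oo[ : set R) h -> (forall x : R, 0 < x -> (0 <= h x)%E) ->
  (\int[entrance s]_(x in `]0%R, +oo[) h x = eta (fun x => h (s `^ al^-1 * x)%R))%E.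
Proof.
move=> s0 mh h0; rewrite integral_mkcond.
rewrite (@integral_wpush _ _ _ _ R Q rho (pt s) mrho rho0 (mpt s)); last 2 first.
- by apply/(measurable_restrictT h (measurable_itv `]0, +oo[)).
- by move=> x; rewrite restrict_gt0; case: ifP => // /h0.
apply: eq_integral => w _; rewrite -/j -/(rho w); have [jw0|jw0] := jE w.
  by rewrite /rho jw0 normr0 invr0 !mul0e.
by rewrite restrict_gt0 pt_gt0.
Qed.

Lemma entrance_support s : 0 < s -> entrance s (~` `]0, +oo[) = 0%E.
Proof.
move=> s0; apply: integral0_eq => w _; have [jw0|jw0] := jE w.
  by rewrite /rho jw0 normr0 invr0 mul0e.
by rewrite indicE memNset ?mule0//= in_itv/= andbT pt_gt0// => /(_ isT).
Qed.

Lemma entrance_sigma_finite s : 0 < s -> sigma_finite setT (entrance s).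
Proof.
move=> s0; exists (fun n => `[- n%:R, n%:R]%classic).
  apply/esym/seteqP; split => // x _; exists (Num.truncn `|x|).+1 => //=.
  by rewrite in_itv/= -ler_norml ltW// truncnS_gt.
(* Where [pt s w] <= n, raising to the power al gives s / J <= n^al, so the weight J^-1 is at most
   [c]. *)
move=> n; split=> //; pose c : R := n%:R `^ al / s.
have c0 : 0 <= c by rewrite divr_ge0 ?powR_ge0// ltW.
apply: (@le_lt_trans _ _ (\int[Q]_w c%:E)%E); last first.
  by rewrite integral_cst_probability ltry.
apply: ge0_le_integral => //.
- by move=> w _; rewrite mule_ge0// lee_fin.
- apply: emeasurable_funM; apply/measurable_EFinP => //.
  apply: (measurableT_comp (f := \1_`[- n%:R, n%:R] : R -> R)) => //.
move=> w _; rewrite -EFinM lee_fin indicE mem_setE in_itv/=.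
have [/andP[_ ptn]|_] := boolP (- n%:R <= pt s w <= n%:R); last by rewrite mulr0.
rewrite mulr1; have [jw0|jw0] := jE w.
  by rewrite /rho jw0 normr0 invr0.
rewrite /c ler_pdivlMr// /rho gtr0_norm// mulrC.
have -> : s / j w = pt s w `^ al.
  rewrite /pt powRM ?powR_ge0// -!powRrM mulNr mulVf ?gt_eqF// powRr1 ?(ltW s0)//.
  by rewrite powR_inv1// ltW.
by apply: ge0_ler_powR; rewrite ?nnegrE ?(ltW al0) ?(ltW (pt_gt0 s0 jw0)).
Qed.

Lemma pssmp_path_scale t s x z : 0 < s -> 0 < x ->
  pssmp_path al t (s `^ al^-1 * x) z = s `^ al^-1 * pssmp_path al (t / s) x z.
Proof.
move=> s0 x0; rewrite /pssmp_path.
have -> : (s `^ al^-1 * x) `^ (- al) = s^-1 * x `^ (- al).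
  rewrite powRM ?powR_ge0 ?(ltW x0)// -powRrM mulrN mulVf ?gt_eqF//.
  by rewrite powR_inv1// ltW.
by rewrite !mulrA.
Qed.

(** By [lt_T0] survival at t means X t > 0, so killing amounts to cutting f off outside ]0, +oo[. *)
Lemma killed_expectation t x (f : R -> R) : 0 <= t ->
  (\int[P x]_(w in [set w | t%:E < T0 (X ^~ w)]) (f (X t w))%:E =
   \int[P x]_w ((EFin \o f) \_ `]0%R, +oo[) (X t w))%E.
Proof.
move=> t0; rewrite integral_mkcond; apply: eq_integral => w _.
have T0X : (t%:E < T0 (X ^~ w))%E <-> 0 < X t w.
  apply: lt_T0 => //.
  - exact: pssMp_cadlag hX w.
  - by move=> s s0; exact: pssMp_ge0 hX _ _ s0.
  - by move=> r s r0 rs; exact: pssMp_cemetery hX r s w r0 rs.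
rewrite restrict_gt0 patchE.
case: ifPn; first by rewrite inE/= => /T0X ->.
by rewrite notin_setE/=; case: ifPn => // /T0X.
Qed.

(** By scaling, running X for time t from s^(1/al) x is s^(1/al) times running it for time t/s from
    x. This is the flow up to the factor (t + s)^(1/al), which [g] absorbs, so the claim is
    invariance of eta applied to [g]. *)
Lemma entrance_eq (s t : R) (f : R -> R) : 0 < s -> 0 <= t ->
  measurable_fun (`]0, +oo[ : set R) f -> (forall x : R, 0 < x -> 0 <= f x) ->
  (\int[entrance s]_(x in `]0%R, +oo[)
     \int[P x]_(w in [set w | t%:E < T0 (X ^~ w)]) (f (X t w))%:E =
   \int[entrance (t + s)%R]_(x in `]0%R, +oo[) (f x)%:E)%E.
Proof.
move=> s0 t0 mf f0.
pose fp := (EFin \o f) \_ `]0%R, +oo[.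
have mfE : measurable_fun (`]0, +oo[ : set R) (EFin \o f) by exact/measurable_EFinP.
have mfp : measurable_fun setT fp by exact/(measurable_restrictT (EFin \o f) (measurable_itv `]0, +oo[)).
have fp0 x : (0 <= fp x)%E.
  by rewrite /fp restrict_gt0; case: ifP => // x0; rewrite lee_fin f0.
have fpE x : 0 < x -> fp x = (f x)%:E.
  by move=> x0; rewrite /fp restrict_gt0 x0.
have mX := measurable_X hX t0.
(* Invariance is known for v > 0, that is t > 0; at t = 0 the claim rests on the initial law of
   X. *)
have [t00|tgt0] := eqVneq t 0.
  subst t; rewrite add0r; apply: eq_integral => x; rewrite inE/= in_itv/= andbT => x0.
  rewrite (killed_expectation x f t0).
  transitivity (\int[P x]_w (f x)%:E)%E; last first.
    by rewrite integral_cst_probability.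
  apply: ge0_ae_eq_integral => //.
  - exact: (measurableT_comp mfp).
  - by move=> w _; rewrite lee_fin f0.
  - by apply: filterS (pssMp_start hX (ltW x0)) => w /= Xx _; rewrite Xx -/fp fpE.
have {}tgt0 : 0 < t by rewrite lt_def tgt0.
pose k x := (\int[Q]_w fp (pssmp_path al t x (y w)))%E.
have mk : measurable_fun setT k.
  exact: (measurable_pssmp_integral al hY t mfp fp0).
have k0 x : (0 <= k x)%E by exact: integral_ge0.
transitivity (\int[entrance s]_(x in `]0%R, +oo[) k x)%E.
  apply: eq_integral => x; rewrite inE/= in_itv/= andbT => x0.
  rewrite (killed_expectation x f t0).
  exact: (integral_pssmp al0 hY mzeta zeta0 xiE hdrift hX hassoc t0 x0 mfp fp0).
apply: (etrans (integral_entrance s0 (measurable_funTS mk) (fun x _ => k0 x))).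
have ts0 : 0 < t + s by rewrite addr_gt0.
have fE0 x : 0 < x -> (0 <= (EFin \o f) x)%E by move=> x0; rewrite lee_fin f0.
apply: (etrans _ (esym (integral_entrance ts0 mfE fE0))).
pose g x := fp ((t + s) `^ al^-1 * x).
have mg : measurable_fun setT g.
  by apply: (measurableT_comp mfp); exact: mulrl_measurable.
(* Chosen so that e^v - 1 = t / s and s e^v = t + s. *)
pose v := ln (1 + t / s).
have ts1 : 1 < 1 + t / s by rewrite ltrDl divr_gt0.
have v0 : 0 < v by exact: ln_gt0.
have yoo : {ae Q, forall w, y w u @[u --> +oo] --> +oo}.
  by apply: filterS (typical_ae hY zeta0 xiE hdrift) => w [].
have markov := pssmp_markov al0 hY mzeta zeta0 xiE hdrift hX hassoc.
have := eta_invariant al0 hY yoo markov mg (fun x => fp0 _) v0.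
have expv : expR v = 1 + t / s by rewrite lnK// posrE (lt_trans ltr01).
have flow_opE x : 0 < x -> flow_op Q al Y g v x = k (s `^ al^-1 * x).
  move=> x0; apply: eq_integral => w _; rewrite /g pssmp_path_scale//; congr fp.
  rewrite /flow expv mulrA -[1 + _ - 1]addrAC subrr add0r; congr (_ * _).
  have -> : t + s = s * (1 + t / s) by field; rewrite gt_eqF.
  rewrite powRM ?(ltW s0) ?(ltW (lt_trans ltr01 ts1))//.
  rewrite -mulrA -powRD ?subrr ?powRr0 ?mulr1//.
  by apply/implyP => _; rewrite gt_eqF// (lt_trans ltr01).
have etaE g1 g2 : (forall x, 0 < x -> g1 x = g2 x) -> eta g1 = eta g2.
  move=> g12; apply: eq_integral => w _; rewrite -/j; have [->|jw0] := jE w.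
    by rewrite normr0 invr0 !mul0e.
  by rewrite g12 ?powR_gt0.
rewrite (etaE _ _ flow_opE) => ->; apply: etaE => x x0.
by rewrite /g fpE// mulr_gt0 ?powR_gt0.
Qed.

Lemma entrance_ssel : ssel al 0 X P entrance.
Proof.
split.
- exact: lexx.
- exact: entrance_support.
- exact: entrance_sigma_finite.
- exact: entrance_eq.
move=> s f s0 mf f0; rewrite mul0r oppr0 powRr0 mul1e.
have mfE : measurable_fun (`]0, +oo[ : set R) (EFin \o f) by exact/measurable_EFinP.
have sa0 : 0 < s `^ al^-1 by rewrite powR_gt0.
have fE0 x : 0 < x -> (0 <= (EFin \o f) x)%E by move=> x0; rewrite lee_fin f0.
pose fs x := (f (s `^ al^-1 * x))%:E.
have mfs : measurable_fun (`]0, +oo[ : set R) fs.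
  apply: (measurable_comp _ _ mfE (measurable_funTS (mulrl_measurable (s `^ al^-1)))) => //.
  by move=> _ [x xpos <-]; move: xpos; rewrite /= !in_itv/= !andbT => x0; rewrite mulr_gt0.
have fs0 x : 0 < x -> (0 <= fs x)%E by move=> x0; rewrite lee_fin f0// mulr_gt0.
apply: (etrans (integral_entrance s0 mfE fE0)).
apply: (etrans _ (esym (integral_entrance ltr01 mfs fs0))).
by rewrite powR1; apply: eq_integral => w _; rewrite mul1r.
Qed.

Lemma entrance_dual_expectation (s : R) (f : R -> R) : 0 < s ->
  measurable_fun (`[0, +oo[ : set R) f -> (forall x : R, 0 <= x -> 0 <= f x) ->
  (\int[entrance s]_(x in `]0%R, +oo[) (f x)%:E)%E =
  dual_expectation Q xi (fun v =>
    let I := fine (exp_functional al v) in (f ((s / I) `^ al^-1) * I^-1)%:E).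
Proof.
move=> s0 mf f0.
have mfE : measurable_fun (`[0, +oo[ : set R) (EFin \o f) by exact/measurable_EFinP.
have subI : `]0, +oo[ `<=` (`[0, +oo[ : set R).
  by move=> x /=; rewrite !in_itv/= !andbT; exact: ltW.
have fE0 x : 0 < x -> (0 <= (EFin \o f) x)%E by move=> x0; rewrite lee_fin f0// ltW.
have mfE' : measurable_fun (`]0, +oo[ : set R) (EFin \o f) by exact: measurable_funS mfE.
apply: (etrans (integral_entrance s0 mfE' fE0)).
pose I w := fine (exp_functional al (dual_path (xi ^~ w))).
have mI : measurable_fun setT I.
  apply: (measurableT_comp (f := fine)) => //.
  exact: (measurable_exp_functional_dual al hY mzeta zeta0 xiE).
have I0 w : 0 <= I w by rewrite fine_ge0// integral_ge0// => u _; exact: expeR_ge0.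
have IVE w : (I w)^-1 = `|I w|^-1 by rewrite ger0_norm.
have mIV : measurable_fun setT (fun w => (I w)^-1).
  by under eq_fun do rewrite IVE; exact: measurable_normV.
have mfpos (g : W -> R) : measurable_fun setT g -> (forall w, 0 <= g w) ->
    measurable_fun setT (fun w => f (g w)).
  move=> mg g0; apply: (measurable_comp _ _ mf mg) => //.
  by move=> _ [w _ <-] /=; rewrite in_itv/= andbT.
rewrite /dual_expectation /eta.
apply: ge0_ae_eq_integral => //.
- apply: emeasurable_funM; apply/measurable_EFinP; first exact: mrho.
  by apply: mfpos => [|w]; [exact: mpt|rewrite mulr_ge0 ?powR_ge0].
- apply/measurable_EFinP; apply: measurable_funM => //.
  apply: mfpos => [|w]; last exact: powR_ge0.
  apply: (measurableT_comp (f := fun z : R => z `^ al^-1)) => //.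
  exact: measurable_funM.
- by move=> w _; rewrite mule_ge0// lee_fin ?rho0// f0// mulr_ge0 ?powR_ge0.
- by move=> w _; rewrite lee_fin mulr_ge0 ?invr_ge0 ?f0 ?powR_ge0 ?I0.
apply: filterS (typical_ae hY zeta0 xiE hdrift) => w gw _ /=.
rewrite (exp_functional_typical al zeta0 xiE gw) -/(perpetuity Y al w) -/j.
(* An infinite exponential functional is read as 0 by [fine], and 0^-1 = 0 makes both integrands
   vanish. *)
have [->|jw0] := jE w; first by rewrite normr0 invr0 mul0e mulr0.
rewrite gtr0_norm// -EFinM mulrC; congr (f _ * _)%:E.
rewrite powRM ?invr_ge0 ?(ltW s0) ?(ltW jw0)//; congr (_ * _).
by rewrite -[in RHS]powR_inv1 ?(ltW jw0)// -powRrM mulN1r.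
Qed.

End entrance_law.

Theorem theorem2 (R : realType) (alpha : R) (halpha : 0 < alpha)
    (d : measure_display) (T : measurableType d)
    (F : R -> set (set T)) (X : R -> T -> R) (P : R -> probability T R)
    (d' : measure_display) (W : measurableType d') (Q : probability W R)
    (xi : R -> W -> \bar R)
    (hX : pssMp alpha F X P)
    (hxi : killed_levy Q xi)
    (hassoc : lamperti_associated alpha X P Q xi)
    (hzero : never_hits_zero X P)
    (hdrift : drifts_to_infinity Q xi) :
  exists mu : R -> {measure set R -> \bar R},
    (forall (s : R) (f : R -> R), 0 < s ->
       measurable_fun (`[0, +oo[ : set R) f -> (forall x : R, 0 <= x -> 0 <= f x) ->
       (\int[mu s]_(x in `]0%R, +oo[) (f x)%:E)%E =
       dual_expectation Q xi (fun v =>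
         let I := fine (exp_functional alpha v) in
         (f ((s / I) `^ alpha^-1) * I^-1)%:E)) /\
    ssel alpha 0 X P mu.
Proof.
have [q [Y [zeta [_ hY [mzeta zeta0 _ _] _ xiE]]]] := hxi.
exists (entrance alpha hY); split.
  move=> s f s0 mf f0.
  exact: (entrance_dual_expectation alpha hY mzeta zeta0 xiE hdrift s0 mf f0).
exact: (entrance_ssel halpha hY mzeta zeta0 xiE hdrift hX hassoc).
Qed.
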